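(* Let $n=dk$ with $d,k$ positive integers, let $\gamma_n=(1,2,\dots,n)$, and let $\omega_d$ be any primitive complex $d$-th root of unity. Then the following expressions are all equal: (i) $A_n^{{\rm maj},{\rm exc},{\rm fix}}(\omega_d,t\omega_d^{-1},s)$; (ii) $\sum_{\sigma\in C_{S_n}(\gamma_n^k)}t^{{\rm exc}(\sigma)}s^{{\rm fix}(\sigma)}$; (iii) $A_k^{{\rm exc},{\rm fix}}\Big(t,\dfrac{s^d+t[d-1]_t}{[d]_t}\Big)[d]_t^k$.
   Context: Permutations act on the right. For $\sigma\in S_m$: ${\rm Exc}(\sigma)=\{i\in[m-1]:i\sigma>i\}$, ${\rm exc}(\sigma)=|{\rm Exc}(\sigma)|$; ${\rm Des}(\sigma)=\{i\in[m-1]:i\sigma>(i+1)\sigma\}$, ${\rm maj}(\sigma)=\sum_{i\in{\rm Des}(\sigma)}i$; ${\rm fix}(\sigma)=|\{i\in[m]:i\sigma=i\}|$. $A_m^{{\rm maj},{\rm exc},{\rm fix}}(q,t,s)=\sum_{\sigma\in S_m}q^{{\rm maj}(\sigma)}t^{{\rm exc}(\sigma)}s^{{\rm fix}(\sigma)}$ and $A_m^{{\rm exc},{\rm fix}}(t,s)=\sum_{\sigma\in S_m}t^{{\rm exc}(\sigma)}s^{{\rm fix}(\sigma)}$. $[m]_t=1+t+\cdots+t^{m-1}$ (so $[0]_t=0$). $C_{S_n}(\gamma_n^k)$ is the centralizer of $\gamma_n^k$ in $S_n$. *)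

(* Defs.v *)
From HB Require Import structures.
From mathcomp Require Import all_boot all_order all_algebra all_fingroup.
From mathcomp Require Import fraction complex reals.
From mathcomp Require Import mpoly.

Set Implicit Arguments.
Unset Strict Implicit.
Unset Printing Implicit Defensive.

Import GRing.Theory.
Local Open Scope ring_scope.

(* The index set [m] = {1, ..., m} is represented by 'I_m, the element i of   *)
(* 'I_m standing for i + 1. The image i sigma is sigma i; the product of      *)
(* {perm _} is (s * t) i = t (s i), in agreement with the right action.       *)

Definition Exc (m : nat) (sigma : 'S_m) : {set 'I_m} :=
  [set i : 'I_m | (i.+1 < m)%N && (i < sigma i)%N].

Definition exc (m : nat) (sigma : 'S_m) : nat := #|Exc sigma|.

(* ordS i is the successor of i modulo m, hence i + 1 when i.+1 < m. *)
Definition Des (m : nat) (sigma : 'S_m) : {set 'I_m} :=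
  [set i : 'I_m | (i.+1 < m)%N && (sigma (ordS i) < sigma i)%N].

(* The summand is i.+1 because i : 'I_m stands for the position i + 1. *)
Definition maj (m : nat) (sigma : 'S_m) : nat := (\sum_(i in Des sigma) i.+1)%N.

Definition fix_ (m : nat) (sigma : 'S_m) : nat :=
  #|[set i : 'I_m | sigma i == i]|.

Definition A_maj_exc_fix (K : nzRingType) (m : nat) (q t s : K) : K :=
  \sum_(sigma : 'S_m) q ^+ maj sigma * t ^+ exc sigma * s ^+ fix_ sigma.

Definition A_exc_fix (K : nzRingType) (m : nat) (t s : K) : K :=
  \sum_(sigma : 'S_m) t ^+ exc sigma * s ^+ fix_ sigma.

Definition qint (K : nzRingType) (m : nat) (t : K) : K := \sum_(i < m) t ^+ i.

Definition gamma (n : nat) : 'S_n := perm (@ordS_inj n).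

(* The field of rational functions C(t, s). *)
Definition ratfun (C : fieldType) : fieldType := {fraction {mpoly C[2]}}.

Definition ratC (C : fieldType) (c : C) : ratfun C := tofrac (mpolyC 2 c).

Definition tvar (C : fieldType) : ratfun C := tofrac (mpolyX C U_(ord0 : 'I_2)).

Definition svar (C : fieldType) : ratfun C :=
  tofrac (mpolyX C U_(ord_max : 'I_2)).

(* Main.v *)
Require Import Defs.
From mathcomp Require Import all_boot all_order all_algebra all_fingroup.
From mathcomp Require Import fraction complex reals.
From mathcomp Require Import mpoly zify ring.
Set Implicit Arguments.
Unset Strict Implicit.
Unset Printing Implicit Defensive.
Import GRing.Theory.
Local Open Scope ring_scope.

                                                                                 
                                                                               
                                                            
                                                                                    
                                                                                     
                                                                                   
                                                                            
                                                                           
                                                                                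
                                                                         
                                                                              
                                                                            
                                                                                
                                                                                 
                                                                                 
                                                                          
                                                                               
                                                   

                                                                           
Definition dex_key (n : nat) (sigma : 'S_n) (i : 'I_n) : nat :=
  ((sigma i <= i) * n + sigma i)%N.

Definition DEX (n : nat) (sigma : 'S_n) : {set 'I_n} :=
  [set i : 'I_n | (i.+1 < n)%N && (dex_key sigma (ordS i) < dex_key sigma i)%N].

Definition dexsum (n : nat) (sigma : 'S_n) : nat :=
  (\sum_(i in DEX sigma) i.+1)%N.

Lemma val_ordS (n : nat) (i : 'I_n) : (i.+1 < n)%N -> ordS i = i.+1 :> nat.
Proof. by move=> lt_i; rewrite /= modn_small. Qed.

Lemma exc_sum (n : nat) (sigma : 'S_n) : exc sigma = (\sum_(i < n) (i < sigma i))%N.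
Proof.
rewrite /exc -sum1_card big_mkcond /=; apply: eq_bigr => i _.
rewrite !inE; case: (ltnP i (sigma i)) => lt_i; last by rewrite andbF.
by rewrite andbT (leq_ltn_trans lt_i).
Qed.

Lemma Des_DEX (n : nat) (sigma : 'S_n) (i : 'I_n) : (i.+1 < n)%N ->
  ((i \in Des sigma) + (ordS i < sigma (ordS i)) =
   (i \in DEX sigma) + (i < sigma i))%N.
Proof.
move=> lt_i; rewrite !inE lt_i !andTb /dex_key.
have neq : sigma (ordS i) != sigma i :> nat.
  by apply/eqP => /val_inj/perm_inj eq_i; have := val_ordS lt_i; rewrite eq_i; lia.
rewrite !val_ordS //; have := ltn_ord (sigma i); have := ltn_ord (sigma (ordS i)).
move: neq; set x := nat_of_ord (sigma i); set y := nat_of_ord (sigma (ordS i)).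
by move=> ? ? ?; case: (leqP x i); case: (leqP y i.+1) => /= ? ?; lia.
Qed.

Lemma maj_dexsum (n : nat) (sigma : 'S_n) : maj sigma = (dexsum sigma + exc sigma)%N.
Proof.
rewrite exc_sum /maj /dexsum big_mkcond [in RHS]big_mkcond /=.
case: n sigma => [|n] sigma; first by rewrite !big_ord0.
pose e k := nat_of_bool (k < sigma (inord k))%N.
have eE (i : 'I_n.+1) : (i < sigma i)%N = e i :> nat by rewrite /e inord_val.
have e_n : e n = 0%N by rewrite /e; have := ltn_ord (sigma (inord n)); lia.
under [X in (_ + X)%N]eq_bigr do rewrite eE.
rewrite !big_ord_recr /= e_n !inE ltnn /= !addn0.
set A := LHS; set B := (X in (X + _)%N); set C := (X in (_ + X)%N).
have H : (A + \sum_(i < n) e i.+1 * i.+1 = B + \sum_(i < n) e i * i.+1)%N.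
  rewrite -!big_split /=; apply: eq_bigr => i _.
  have lt_i : ((widen_ord (leqnSn n) i).+1 < n.+1)%N by rewrite ltnS /=.
  have := Des_DEX sigma lt_i; rewrite !eE val_ordS //=.
  by do 2!case: ifP => _; nia.
have H1 : (\sum_(i < n) e i.+1 * i.+1 = \sum_(i < n) e i * i)%N.
  have := @big_ord_recr _ _ addn n (fun i => e i * i)%N.
  by rewrite big_ord_recl /= e_n mul0n addn0 muln0 add0n.
have H2 : (\sum_(i < n) e i * i.+1 = \sum_(i < n) e i * i + C)%N.
  by rewrite -big_split /=; apply: eq_bigr => i _; rewrite mulnS addnC.
by move: H; rewrite H1 H2; lia.
Qed.

Lemma lex_ltn (n x y i j : nat) : (i < n)%N -> (j < n)%N ->
  (x * n + i < y * n + j)%N = (x < y)%N || (x == y) && (i < j)%N.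
Proof.
move=> lt_i lt_j; case: (ltngtP x y) => [lt_xy|lt_yx|->] /=; last by rewrite ltn_add2l.
  by apply/idP; nia.
by apply/negbTE/negP; nia.
Qed.

Lemma double_bool_ltn (a b : nat) (u w : bool) :
  (a.*2 + u < b.*2 + w)%N = (a < b)%N || (a == b) && (~~ u && w).
Proof. by case: u; case: w; case: (ltngtP a b) => /=; lia. Qed.

Lemma double_bool_eq (a b : nat) (u w : bool) :
  (a.*2 + u == b.*2 + w)%N = (a == b) && (u == w).
Proof. by case: u; case: w; case: (ltngtP a b) => /=; lia. Qed.

Lemma card_ord_itv (n a b : nat) : (b <= n)%N ->
  #|[set i : 'I_n | (a <= i < b)%N]| = (b - a)%N.
Proof.
move=> le_bn; rewrite -sum1_card.
under eq_bigl do rewrite inE.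
rewrite -(big_mkord (fun i => (a <= i) && (i < b))%N (fun=> 1%N)).
rewrite -(big_nat_widen 0 b n (leq a) (fun=> 1%N)) //.
have -> : (\sum_(0 <= i < b | a <= i) 1 = \sum_(a <= i < b) 1)%N.
  by rewrite (big_nat_widenl a 0 b xpredT).
by rewrite sum_nat_const_nat muln1.
Qed.

Section Rank.
Variables (n : nat) (key : 'I_n -> nat).

Definition rank (j : 'I_n) : nat := #|[set i | (key i < key j)%N]|.

Lemma rank_ltn j : (rank j < n)%N.
Proof.
rewrite -[X in (_ < X)%N]card_ord -cardsT; apply: proper_card.
by apply/properP; split; [exact: subsetT | exists j; rewrite !inE ?ltnn].
Qed.

Definition rank_ord j := Ordinal (rank_ltn j).

Lemma ltn_rank i j : (key i < key j)%N -> (rank i < rank j)%N.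
Proof.
move=> lt_ij; apply: proper_card; apply/properP; split.
  by apply/subsetP => k; rewrite !inE => /ltn_trans; apply.
by exists i; rewrite !inE ?ltnn.
Qed.

Lemma rank_ord_inj : injective key -> injective rank_ord.
Proof.
move=> key_inj i j [eq_ij]; apply: key_inj.
by case: (ltngtP (key i) (key j)) => // /ltn_rank; rewrite eq_ij ltnn.
Qed.

Lemma rank_unique (tau : 'S_n) :
  (forall i j, (tau i < tau j)%N = (key i < key j)%N) -> forall j, rank j = tau j.
Proof.
move=> tauP j; rewrite -[RHS]subn0 -(@card_ord_itv n 0 (tau j)) 1?ltnW //.
rewrite -(card_preimset _ (@perm_inj _ tau)).
by apply: eq_card => i; rewrite !inE tauP.
Qed.
End Rank.

Section Words.
Variables (n N : nat).
Implicit Types (sigma : 'S_n) (c : {ffun 'I_n -> 'I_N}).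
Implicit Types (v : {ffun 'I_n -> 'I_N * bool}) (i j : 'I_n).

Definition compat_key sigma c i : nat :=
  (((c i).*2 + (sigma i <= i)) * n + sigma i)%N.

Definition compat sigma c : bool :=
  [forall i : 'I_n, forall j : 'I_n, (i < j)%N ==> (compat_key sigma c i < compat_key sigma c j)%N].

Definition word_key v j : nat := (((v j).1.*2 + (v j).2) * n + j)%N.

Lemma word_key_inj v : injective (word_key v).
Proof.
move=> i j eq_ij; apply: val_inj => /=.
have lt_ij : (word_key v i < word_key v j)%N = false by rewrite eq_ij ltnn.
have lt_ji : (word_key v j < word_key v i)%N = false by rewrite eq_ij ltnn.
move: lt_ij lt_ji; rewrite !lex_ltn // !double_bool_ltn !double_bool_eq.
case: (ltngtP (v i).1 (v j).1) => //= _; case: (v i).2; case: (v j).2 => //=;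
  by case: ltngtP.
Qed.

Definition word_rank v : 'S_n := perm (rank_ord_inj (@word_key_inj v)).

Lemma word_rankE v j : word_rank v j = rank (word_key v) j :> nat.
Proof. by rewrite permE. Qed.

Lemma ltn_word_rank v i j :
  (word_rank v i < word_rank v j)%N = (word_key v i < word_key v j)%N.
Proof.
rewrite !word_rankE; case: (ltngtP (word_key v i) (word_key v j)).
- exact: ltn_rank.
- by move/ltn_rank; case: ltngtP.
- by move/word_key_inj ->; rewrite ltnn.
Qed.

                                                                             
Definition encode (p : 'S_n * {ffun 'I_n -> 'I_N}) : {ffun 'I_n -> 'I_N * bool} :=
  [ffun j => (p.2 ((p.1^-1)%g j), (j <= (p.1^-1)%g j)%N)].

Definition decode v : 'S_n * {ffun 'I_n -> 'I_N} :=
  (((word_rank v)^-1)%g, [ffun i => (v (((word_rank v)^-1)%g i)).1]).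

Lemma word_key_encode sigma c i :
  word_key (encode (sigma, c)) (sigma i) = compat_key sigma c i.
Proof. by rewrite /word_key ffunE /= permK. Qed.

Lemma decode_encode sigma c :
  (decode (encode (sigma, c)) == (sigma, c)) = compat sigma c.
Proof.
set v := encode _; apply/eqP/idP.
  case=> eq_sigma _; apply/forallP => i; apply/forallP => j; apply/implyP.
  have rk k : word_rank v (sigma k) = k by rewrite -[RHS](permKV (word_rank v)) eq_sigma.
  by rewrite -!word_key_encode -/v -ltn_word_rank !rk.
move=> /forallP compat_c.
have mono (i j : 'I_n) : (i < j)%N = (compat_key sigma c i < compat_key sigma c j)%N.
  have lt_key (k l : 'I_n) : (k < l)%N -> (compat_key sigma c k < compat_key sigma c l)%N.
    by move=> lt_kl; have /forallP/(_ l)/implyP := compat_c k; apply.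
  apply/idP/idP; first exact: lt_key.
  case: (ltngtP i j) => // [/lt_key lt_ji|/val_inj ->]; last by rewrite ltnn.
  by rewrite ltnNge (ltnW lt_ji).
have rk : word_rank v = (sigma^-1)%g.
  apply/permP => j; apply: val_inj; rewrite /= word_rankE; apply: rank_unique => k l.
  by rewrite mono -!word_key_encode !permKV.
rewrite /decode rk invgK; congr pair; apply/ffunP => i.
by rewrite !ffunE /= permK.
Qed.

Definition consistent v : bool := [forall j, (v j).2 == (j <= word_rank v j)%N].

Lemma encode_decode v : (encode (decode v) == v) = consistent v.
Proof.
apply/eqP/forallP => [eq_v j|cons_v].
  by rewrite -{1}eq_v ffunE /= invgK.
apply/ffunP => j; rewrite ffunE /= ffunE invgK permK -(eqP (cons_v j)).
by case: (v j).
Qed.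

Definition below v (a : nat) : nat := #|[set j | ((v j).1 < a)%N]|.

Lemma word_rank_barred v j : ~~ (v j).2 ->
  word_rank v j = (below v (v j).1 + #|[set i : 'I_n | (i < j)%N && (v i == v j)]|)%N :> nat.
Proof.
move=> bar; rewrite word_rankE /rank /below.
rewrite (_ : [set i | _] = [set i | (v i).1 < (v j).1] :|:
                           [set i : 'I_n | (i < j)%N && (v i == v j)])%N.
  rewrite cardsU (_ : _ :&: _ = set0) ?cards0 ?subn0 //.
  by apply/setP => i; rewrite !inE; case: (v i =P v j) => [->|]; rewrite ?ltnn ?andbF.
apply/setP => i; rewrite !inE lex_ltn // double_bool_ltn double_bool_eq.
rewrite -pair_eqE /pair_eq /=.
by rewrite (negbTE bar) !andbF orbF [in RHS]andbC.
Qed.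

Lemma word_rank_unbarred v j : (v j).2 ->
  ((word_rank v j).+1 + #|[set i : 'I_n | (j < i)%N && (v i == v j)]| = below v (v j).1.+1)%N.
Proof.
move=> unbar; rewrite word_rankE /rank /below; set X := [set i | _ && _].
rewrite addSnnS -add1n (_ : 1%N = (j \notin X)); last by rewrite inE ltnn.
rewrite -cardsU1 -[LHS]subn0 -(cards0 'I_n); set A := [set i | _].
rewrite (_ : set0 = A :&: (j |: X)).
  rewrite -cardsU; apply: eq_card => i.
  rewrite !inE lex_ltn // double_bool_ltn double_bool_eq.
  rewrite -pair_eqE /pair_eq /= unbar andbT.
  have [->|neq_ij] := eqVneq i j; first by rewrite ltnSn !orbT.
  have lt_ij : (j < i)%N = ~~ (i < j)%N by rewrite -leqNgt ltn_neqAle eq_sym neq_ij.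
  rewrite orFb -val_eqE /= ltnS lt_ij; case: (ltngtP (v i).1 (v j).1) => //= _.
    by rewrite andbF.
  by case: (v i).2; case: (i < j)%N.
apply/setP => i; rewrite !inE; have [->|neq_ij] := eqVneq i j; first by rewrite !ltnn.
rewrite /= lex_ltn //; case: (v i =P v j) => [->|]; last by rewrite !andbF.
by rewrite ltnn eqxx /= andbT; case: ltngtP.
Qed.
Lemma below_leq v a : (below v a <= n)%N.
Proof. by rewrite -[X in (_ <= X)%N]card_ord max_card. Qed.

Lemma consistentP v :
  reflect (forall j, if (v j).2 then (j < below v (v j).1.+1)%N
                     else (below v (v j).1 < j)%N)
          (consistent v).
Proof.
apply: (iffP forallP) => [cons_v j|cons_v j].
  have := cons_v j; case: ifP => vj2 /eqP /esym le_j.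
    by rewrite -(word_rank_unbarred vj2) (leq_ltn_trans le_j) // ltn_addr.
  move/negbT: le_j; rewrite -ltnNge; apply: leq_ltn_trans.
  by rewrite word_rank_barred ?vj2 // leq_addr.
apply/eqP/esym; have := cons_v j; case: ifP => vj2 lt_j.
  have := word_rank_unbarred vj2; set X := [set i : 'I_n | _].
  have : (#|X| <= #|[set i : 'I_n | (j.+1 <= i < below v (v j).1.+1)%N]|)%N.
    apply/subset_leq_card/subsetP => i; rewrite !inE => /andP[-> /eqP eq_v].
    by have := cons_v i; rewrite eq_v vj2.
  by rewrite card_ord_itv ?below_leq //; lia.
apply/negbTE; rewrite -ltnNge word_rank_barred ?vj2 //; set X := [set i : 'I_n | _].
have : (#|X| <= #|[set i : 'I_n | ((below v (v j).1).+1 <= i < j)%N]|)%N.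
  apply/subset_leq_card/subsetP => i; rewrite !inE => /andP[-> /eqP eq_v].
  by have := cons_v i; rewrite eq_v vj2 andbT.
have le_jn : (j <= n)%N by apply: ltnW.
by rewrite card_ord_itv //; lia.
Qed.

Lemma consistent_fix v j : consistent v ->
  (word_rank v j == j) =
  (v j).2 && [forall i : 'I_n, (j < i < below v (v j).1.+1)%N ==> (v i == v j)].
Proof.
move=> cons_v; have /forallP/(_ j)/eqP vj2 := cons_v.
case: (boolP (v j).2) => [ub|bar] /=; last first.
  by move: bar; rewrite vj2; case: ltngtP => // lt _; apply/eqP => eqj; rewrite eqj ltnn in lt.
have := word_rank_unbarred ub; set X := [set i : 'I_n | _] => rkE.
set I := [set i : 'I_n | (j.+1 <= i < below v (v j).1.+1)%N].
have subXI : X \subset I.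
  apply/subsetP => i; rewrite !inE => /andP[-> /eqP eq_v].
  by have /consistentP/(_ i) := cons_v; rewrite eq_v ub.
have cardI : #|I| = (below v (v j).1.+1 - j.+1)%N by rewrite card_ord_itv ?below_leq.
have lt_j : (j < below v (v j).1.+1)%N by have /consistentP/(_ j) := cons_v; rewrite ub.
have -> : (word_rank v j == j) = (#|X| == #|I|).
  rewrite cardI (_ : (word_rank v j == j) = (word_rank v j == j :> nat)) //.
  move: rkE lt_j; set r := nat_of_ord (word_rank v j); set k := nat_of_ord j.
  set b := below _ _; set x := #|_| => rkE lt_j.
  by apply/eqP/eqP; lia.
rewrite (subset_leqif_cards subXI) eqEsubset subXI /=.
apply/subsetP/forallP => [subIX i|allv i].
  by apply/implyP => Ii; have := subIX i; rewrite !inE => /(_ Ii)/andP[].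
by rewrite !inE => Ii; have /implyP/(_ Ii) := allv i; case/andP: Ii => ->.
Qed.
End Words.

Lemma exc_fix_prod (K : comNzRingType) (n : nat) (sigma : 'S_n) (t s : K) :
  t ^+ exc sigma * s ^+ fix_ sigma =
  \prod_(i < n) (if sigma i == i then s else if (i < sigma i)%N then t else 1).
Proof.
rewrite exc_sum /fix_ -sum1_card [X in s ^+ X]big_mkcond.
rewrite /= !expr_sum -big_split /=.
apply: eq_bigr => i _; rewrite inE.
by case: eqP => [->|_]; rewrite ?ltnn ?mul1r //; case: ltnP; rewrite ?mulr1.
Qed.

Definition content (n N : nat) (f : 'I_n -> 'I_N) : 'X_{1..N} :=
  [multinom #|[set i | f i == a]| | a < N].

Lemma content_perm (n N : nat) (f : 'I_n -> 'I_N) (sigma : 'S_n) :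
  content (f \o sigma) = content f.
Proof.
apply/mnmP => a; rewrite !mnmE -[RHS](card_preimset _ (@perm_inj _ sigma)).
by apply: eq_card => i; rewrite !inE.
Qed.

Lemma compat_sum (K : comNzRingType) (n N : nat) (t s : K) (m : 'X_{1..N}) :
  \sum_(p : 'S_n * {ffun 'I_n -> 'I_N} | compat p.1 p.2 && (content p.2 == m))
     t ^+ exc p.1 * s ^+ fix_ p.1 =
  \sum_(v : {ffun 'I_n -> 'I_N * bool} | consistent v && (content (fst \o v) == m))
     \prod_j (if word_rank v j == j then s else if (v j).2 then 1 else t).
Proof.
rewrite [RHS](reindex_onto (@encode n N) (@decode n N)) /=; last first.
  by move=> v /andP[cons_v _]; apply/eqP; rewrite encode_decode.
apply: eq_big => [[sigma c]|[sigma c] /andP[/= compat_c _]] /=.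
  have -> : content (fst \o encode (sigma, c)) = content c.
    rewrite -[RHS](content_perm _ (sigma^-1)%g); apply/mnmP => a.
    by rewrite !mnmE; apply: eq_card => j; rewrite !inE /= ffunE.
  rewrite decode_encode; case: (boolP (compat sigma c)) => [compat_c|]; last by rewrite andbF.
  rewrite andbT -encode_decode (_ : decode _ = (sigma, c)) ?eqxx //.
  by apply/eqP; rewrite decode_encode.
have /eqP[eq_sigma _] : decode (encode (sigma, c)) == (sigma, c) by rewrite decode_encode.
have -> : word_rank (encode (sigma, c)) = (sigma^-1)%g by rewrite -{2}eq_sigma invgK.
rewrite exc_fix_prod (reindex_inj (@perm_inj _ (sigma^-1)%g)) /=.
apply: eq_bigr => j _; rewrite permKV ffunE /= eq_sym.
by case: eqP => // _; case: leqP.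
Qed.

Lemma prod_sum_leq (R : comNzRingType) (N B : nat) (m : 'I_N -> nat)
    (F : 'I_N -> nat -> R) : (forall b, (m b < B)%N) ->
  \prod_b \sum_(e < (m b).+1) F b e =
  \sum_(f : {ffun 'I_N -> 'I_B} | [forall b, (f b <= m b)%N]) \prod_b F b (f b).
Proof.
move=> ltmB; under eq_bigr => b _ do rewrite (big_ord_widen _ (F b) (ltmB b)).
rewrite (bigA_distr_big_dep (fun b (e : 'I_B) => (e < (m b).+1)%N)) /=.
by apply: eq_bigl => f; apply/familyP/forallP => H b; exact: H b.
Qed.

                                                               
Lemma suffix_expand (K : comNzRingType) (s : K) (A : nat -> K) (u : nat -> bool) M :
  \prod_(o < M) (if all u (iota o (M - o)) then s else A o) =
  \sum_(e < M.+1) \prod_(o < M)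
    (if (M - e <= o)%N then (u o)%:R * s
     else if o.+1 == (M - e)%N then (~~ u o)%:R * A o else A o).
Proof.
elim: M => [|M IH]; first by rewrite big_ord1 !big_ord0.
rewrite [LHS]big_ord_recr /= subSnn /= andbT [RHS]big_ord_recl.
rewrite [X in _ = X + _]big_ord_recr /= subn0 ltnn eqxx.
have -> : \sum_(i < M.+1) \prod_(o < M.+1)
    (if (M.+1 - lift ord0 i <= o)%N then (u o)%:R * s
     else if o.+1 == (M.+1 - lift ord0 i)%N then (~~ u o)%:R * A o else A o) =
    (u M)%:R * s * \prod_(o < M) (if all u (iota o (M - o)) then s else A o).
  rewrite IH mulr_sumr; apply: eq_bigr => e _.
  rewrite big_ord_recr /= /bump /= add1n subSS leq_subr mulrC; congr (_ * _).
have -> : \prod_(i < M) (if all u (iota i (M.+1 - i)) then s else A i) =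
    \prod_(i < M) (if all u (iota i (M - i)) && u M then s else A i).
  apply: eq_bigr => i _; rewrite subSn 1?ltnW // -addn1 iotaD all_cat /= andbT.
  by rewrite subnKC // ltnW.
have -> : \prod_(i < M) (if (M.+1 <= i)%N then (u i)%:R * s
     else if i.+1 == M.+1 then (~~ u i)%:R * A i else A i) = \prod_(i < M) A i.
  apply: eq_bigr => i _; have := ltn_ord i; rewrite eqSS => lt_i.
  by rewrite leqNgt ltnS ltnW // ltn_eqF.
case: (u M); rewrite /= ?mul1r ?mul0r ?mulr0 ?add0r ?addr0.
  by rewrite mulrC; congr (_ * _); apply: eq_bigr => i _; rewrite andbT.
by congr (_ * _); apply: eq_bigr => i _; rewrite andbF.
Qed.

Lemma big_Rank (R : Type) (idx : R) (op : Monoid.com_law idx) (N : nat)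
    (m : 'I_N -> nat) (F : 'I_(\sum_b m b) -> R) :
  \big[op/idx]_j F j = \big[op/idx]_b \big[op/idx]_(o < m b) F (tagnat.Rank b o).
Proof.
rewrite (reindex _ (tagnat.rank_bij_on (p_ := m))) /=.
by rewrite sig_big_dep; apply: eq_bigr => -[b o] _.
Qed.

Lemma mcoeff_rows (K : comNzRingType) (L : finType) (N : nat) (pr : L -> 'I_N)
    (m : 'X_{1..N}) (F : 'I_N -> nat -> nat -> L -> K) :
  \sum_(v : {ffun 'I_(\sum_b m b) -> L} | content (pr \o v) == m)
     \prod_b \sum_(e < (m b).+1) \prod_(o < m b) F b e o (v (tagnat.Rank b o)) =
  (\prod_b \sum_(e < (m b).+1) \prod_(o < m b)
     \sum_l F b e o l *: 'X_(pr l))@_m.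
Proof.
pose B := (\sum_b m b)%N.+1.
have ltmB b : (m b < B)%N by rewrite ltnS (bigD1 b) //= leq_addr.
rewrite (prod_sum_leq (fun b e => \prod_(o < m b) \sum_l F b e o l *: 'X_(pr l)) ltmB).
transitivity (\sum_(v : {ffun 'I_(\sum_b m b) -> L} | content (pr \o v) == m)
    \sum_(f : {ffun 'I_N -> 'I_B} | [forall b, (f b <= m b)%N])
      \prod_b \prod_(o < m b) F b (f b) o (v (tagnat.Rank b o))).
  apply: eq_bigr => v _.
  exact: (prod_sum_leq (fun b e => \prod_(o < m b) F b e o (v (tagnat.Rank b o))) ltmB).
rewrite exchange_big raddf_sum /=; apply: eq_bigr => f _.
pose G (j : 'I_(\sum_b m b)) l := F (tagnat.sig1 j) (f (tagnat.sig1 j)) (tagnat.sig2 j) l.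
have GE b (o : 'I_(m b)) l : G (tagnat.Rank b o) l = F b (f b) o l.
  by rewrite /G tagnat.Rank2K /= tagnat.Rank1K.
have -> : \prod_b \prod_(o < m b) \sum_l F b (f b) o l *: ('X_(pr l) : {mpoly K[N]}) =
          \prod_j \sum_l G j l *: 'X_(pr l).
  rewrite [RHS]big_Rank; apply: eq_bigr => b _; apply: eq_bigr => o _.
  by apply: eq_bigr => l _; rewrite GE.
rewrite bigA_distr_bigA raddf_sum /= big_mkcond /=; apply: eq_bigr => v _.
rewrite scaler_prod mcoeffZ.
rewrite -(big_morph _ (@mpolyXD _ K) (@mpolyX0 _ K)) mcoeffX.
have -> : (\sum_j U_(pr (v j)))%MM = content (pr \o v).
  apply/mnmP => a; rewrite mnm_sumE mnmE -sum1_card [RHS]big_mkcond /=.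
  by apply: eq_bigr => j _; rewrite inE mnm1E; case: eqP.
case: eqP => _; rewrite ?mulr1 ?mulr0 // [RHS]big_Rank.
by apply: eq_bigr => b _; apply: eq_bigr => o _; rewrite GE.
Qed.

Section Rows.
Variables (K : comNzRingType) (N : nat) (t : K).
Implicit Types (a b : 'I_N) (m : 'X_{1..N}).

Definition zpol (b : nat) : {mpoly K[N]} :=
  \sum_(a < N) (if (a < b)%N then t else 1) *: 'X_a.

Definition lpol b : {mpoly K[N]} := zpol b + t *: 'X_b.

Definition slot b (o : nat) : {mpoly K[N]} := if o is 0%N then zpol b else lpol b.

Definition derow b (i : nat) : {mpoly K[N]} :=
  if i is i'.+1 then (\prod_(o < i') slot b o) * (slot b i' - 'X_b) else 1.

Definition wrow (r : K) b (M : nat) : {mpoly K[N]} :=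
  \sum_(e < M.+1) derow b (M - e) * (r *: 'X_b) ^+ e.

Definition word_coef (r : K) m : K := (\prod_b wrow r b (m b))@_m.

Definition allowed b (o : nat) (l : 'I_N * bool) : bool :=
  if l.2 then (b <= l.1)%N else (l.1 < b)%N || (l.1 == b) && (0 < o)%N.

Definition letter_wt b (o : nat) (l : 'I_N * bool) : K :=
  (allowed b o l)%:R * (if l.2 then 1 else t).

Lemma sum_letter_wt b o : \sum_l letter_wt b o l *: 'X_l.1 = slot b o.
Proof.
rewrite -(pair_big xpredT xpredT (fun a u => letter_wt b o (a, u) *: 'X_a)) /=.
have -> : slot b o = \sum_(a < N) ((if (a < b)%N then t else 1) +
                             ((a == b) && (0 < o)%N)%:R * t) *: 'X_a.
  under eq_bigr do rewrite scalerDl.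
  rewrite big_split /= -/(zpol b); case: o => [|o] /=.
    by rewrite [X in _ + X]big1 ?addr0 // => a _; rewrite andbF mul0r scale0r.
  congr (_ + _); rewrite (bigD1 b) //= eqxx mul1r big1 ?addr0 // => a /negbTE ->.
  by rewrite mul0r scale0r.
apply: eq_bigr => a _; rewrite big_bool /= -scalerDl /letter_wt /allowed /= mulr1.
congr (_ *: _); rewrite -(inj_eq val_inj) /=; case: ltngtP => _ /=;
  by rewrite ?mul1r ?mul0r ?addr0 ?add0r.
Qed.

Lemma sum_row_entry s b M o :
  \sum_l (if (M <= o)%N then (l == (b, true))%:R * s
          else if o.+1 == M then (l != (b, true))%:R * letter_wt b o l
          else letter_wt b o l) *: 'X_l.1 =
  if (M <= o)%N then s *: 'X_b else
  if o.+1 == M then slot b o - 'X_b else slot b o.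
Proof.
case: leqP => [_|_].
  rewrite (bigD1 (b, true)) //= eqxx mul1r big1 ?addr0 // => l /negbTE ->.
  by rewrite mul0r scale0r.
case: eqP => _; rewrite -sum_letter_wt //.
rewrite [in RHS](bigD1 (b, true)) //= [in LHS](bigD1 (b, true)) //= eqxx mul0r scale0r add0r.
have -> : letter_wt b o (b, true) = 1 by rewrite /letter_wt /allowed /= leqnn mulr1.
rewrite scale1r addrAC subrr add0r.
by apply: eq_bigr => l ->; rewrite mul1r.
Qed.

Lemma prod_row_entry s b M e : (e <= M)%N ->
  \prod_(o < M) (if (M - e <= o)%N then s *: 'X_b else
                 if o.+1 == (M - e)%N then slot b o - 'X_b else slot b o) =
  derow b (M - e) * (s *: 'X_b) ^+ e.
Proof.
move=> le_eM; have eqM : M = (M - e + e)%N by rewrite subnK.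
move: (M - e)%N eqM => i ->; rewrite big_split_ord /=; congr (_ * _); last first.
  rewrite -[in RHS](card_ord e) -prodr_const; apply: eq_bigr => o _.
  by rewrite leq_addr.
case: i => [|i]; first by rewrite big_ord0.
rewrite big_ord_recr /= ltnn eqxx; congr (_ * _); apply: eq_bigr => o _.
by have lt_o := ltn_ord o; rewrite ifN -?ltnNge ?ltnS 1?ltnW // eqSS ltn_eqF.
Qed.

Lemma below_content n m (v : {ffun 'I_n -> 'I_N * bool}) (a : nat) :
  content (fst \o v) = m -> below v a = (\sum_(b < N | (b < a)%N) m b)%N.
Proof.
move=> <-; rewrite /below -sum1_card (partition_big (fst \o v) (fun b : 'I_N => (b < a)%N)) /=.
  apply: eq_bigr => b lt_ba; rewrite mnmE -sum1_card; apply: eq_bigl => j.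
  by rewrite !inE; case: eqP => [->|]; rewrite ?lt_ba ?andbF.
by move=> j; rewrite inE.
Qed.

Lemma below_word_rank n (v : {ffun 'I_n -> 'I_N * bool}) j :
  (below v (v j).1 <= word_rank v j)%N.
Proof.
rewrite word_rankE; apply/subset_leq_card/subsetP => i; rewrite !inE => lt_i.
by rewrite lex_ltn // double_bool_ltn lt_i.
Qed.

Section Blocks.
Variables (m : 'X_{1..N}) (v : {ffun 'I_(\sum_b m b) -> 'I_N * bool}).
Hypothesis v_m : content (fst \o v) = m.

Let p (a : nat) := (\sum_(b < N | (b < a)%N) m b)%N.

Let pS b : p b.+1 = (p b + m b)%N.
Proof.
rewrite /p (bigD1 b) //= addnC; congr (_ + _)%N; apply: eq_bigl => a.
by rewrite ltnS ltn_neqAle andbC.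
Qed.

Let leq_p x y : (x <= y)%N -> (p x <= p y)%N.
Proof.
move=> le_xy; rewrite /p [leqRHS](bigID (fun b : 'I_N => (b < x)%N)) /=.
apply: leq_trans (leq_addr _ _); rewrite leq_eqVlt; apply/orP; left; apply/eqP.
by apply: eq_bigl => b; case: (ltnP b x) => [/leq_trans->|]; rewrite ?andbF.
Qed.

Let pRank b (o : 'I_(m b)) : tagnat.Rank b o = (p b + o)%N :> nat.
Proof. exact: tagnat.RankEsum. Qed.

Let belowE (x : nat) : below v x = p x.
Proof. exact: below_content. Qed.

Lemma consistent_allowed :
  consistent v = [forall b, forall o : 'I_(m b), allowed b o (v (tagnat.Rank b o))].
Proof.
have allowedE b (o : 'I_(m b)) (j := tagnat.Rank b o) : allowed b o (v j) =
    if (v j).2 then (j < below v (v j).1.+1)%N else (below v (v j).1 < j)%N.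
  rewrite !belowE /allowed; set a := (v j).1; have jE : j = (p b + o)%N :> nat := pRank o.
  have lt_o := ltn_ord o; have pSb := pS b; have pSa := pS a.
  case: ifP => _.
    case: (leqP b a) => [le_ba|lt_ab]; have := @leq_p.
      by move=> /(_ b.+1 a.+1 le_ba); lia.
    by move=> /(_ a.+1 b lt_ab); lia.
  have m_a : (0 < m a)%N.
    by rewrite -v_m mnmE card_gt0; apply/set0Pn; exists j; rewrite inE /=.
  rewrite jE -val_eqE /=; case: (ltngtP a b) => [lt_ab|lt_ba|/val_inj ->] /=.
  - by have := @leq_p a.+1 b lt_ab; lia.
  - by have := @leq_p b.+1 a lt_ba; lia.
  - by lia.
apply/consistentP/forallP => [cons_v b|allow_v j].
  by apply/forallP => o; rewrite allowedE; apply: cons_v.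
by have /forallP/(_ (tagnat.sig2 j)) := allow_v (tagnat.sig1 j); rewrite allowedE tagnat.sig2K.
Qed.

Lemma consistent_fix_block b (o : 'I_(m b)) : consistent v ->
  (word_rank v (tagnat.Rank b o) == tagnat.Rank b o) =
  [forall o' : 'I_(m b), (o <= o')%N ==> (v (tagnat.Rank b o') == (b, true))].
Proof.
move=> cons_v; set j := tagnat.Rank b o; have lt_o := ltn_ord o; have pSb := pS b.
apply/idP/forallP => [fix_j|all_b].
  have /forallP/(_ b)/forallP/(_ o) : [forall b, forall o : 'I_(m b),
    allowed b o (v (tagnat.Rank b o))] by rewrite -consistent_allowed.
  have := below_word_rank v j; rewrite (eqP fix_j) belowE.
  have -> : j = (p b + o)%N :> nat := pRank o; move=> le_p.
  move: fix_j; rewrite consistent_fix // belowE /allowed => /andP[v2 /forallP all_v].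
  rewrite -/j v2 => le_b; have eq_b : (v j).1 = b.
    apply/val_inj/eqP; rewrite eqn_leq le_b andbT leqNgt; apply/negP => lt_b.
    by have := leq_p (lt_b : (b < (v j).1)%N); lia.
  have vj : v j = (b, true) by rewrite [v j]surjective_pairing v2 eq_b.
  move=> o'; apply/implyP; rewrite leq_eqVlt => /orP[/eqP/val_inj <-|lt_oo'].
    by rewrite -/j vj.
  have /implyP := all_v (tagnat.Rank b o'); rewrite vj; apply.
  by rewrite !pRank ltn_add2l lt_oo' pSb ltn_add2l ltn_ord.
have vj : v j = (b, true) by have /implyP/(_ (leqnn o))/eqP := all_b o.
rewrite consistent_fix // vj [(b, true).2]/= [(b, true).1]/= belowE.
apply/forallP => i; apply/implyP; have -> : j = (p b + o)%N :> nat := pRank o.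
move=> /andP[lt_i lt_ip].
have le_i := leq_trans (leq_addr o (p b)) (ltnW lt_i).
have lt_im : (i - p b < m b)%N by rewrite pSb in lt_ip; lia.
have -> : i = tagnat.Rank b (Ordinal lt_im).
  by apply: ord_inj; rewrite pRank /= subnKC.
have /implyP := all_b (Ordinal lt_im); apply => /=.
by rewrite leq_subRL //; apply: ltnW.
Qed.

Lemma word_weight s :
  (if consistent v then
     \prod_j (if word_rank v j == j then s else if (v j).2 then 1 else t) else 0) =
  \prod_b \prod_(o < m b)
    (if [forall o' : 'I_(m b), (o <= o')%N ==> (v (tagnat.Rank b o') == (b, true))]
     then s else letter_wt b o (v (tagnat.Rank b o))).
Proof.
case: ifPn => [cons_v|].
  rewrite big_Rank; apply: eq_bigr => b _; apply: eq_bigr => o _.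
  rewrite consistent_fix_block //; case: ifP => // _.
  have /forallP/(_ b)/forallP/(_ o) allow : [forall b, forall o : 'I_(m b),
    allowed b o (v (tagnat.Rank b o))] by rewrite -consistent_allowed.
  by rewrite /letter_wt allow mul1r.
rewrite consistent_allowed negb_forall => /existsP[b].
rewrite negb_forall => /existsP[o not_allow].
rewrite (bigD1 b) //= (bigD1 o) //= ifN; last first.
  apply/negP => /forallP/(_ o)/implyP/(_ (leqnn o))/eqP vj.
  by move: not_allow; rewrite vj /allowed /= leqnn.
by rewrite /letter_wt (negbTE not_allow) !mul0r.
Qed.
End Blocks.

Lemma word_sum s m (n := (\sum_b m b)%N) :
  \sum_(v : {ffun 'I_n -> 'I_N * bool} | consistent v && (content (fst \o v) == m))
     \prod_j (if word_rank v j == j then s else if (v j).2 then 1 else t) =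
  word_coef s m.
Proof.
pose F b e o (l : 'I_N * bool) : K :=
  if (m b - e <= o)%N then (l == (b, true))%:R * s
  else if o.+1 == (m b - e)%N then (l != (b, true))%:R * letter_wt b o l
  else letter_wt b o l.
transitivity (\sum_(v : {ffun 'I_n -> 'I_N * bool} | content (fst \o v) == m)
   \prod_b \sum_(e < (m b).+1) \prod_(o < m b) F b e o (v (tagnat.Rank b o))).
  under eq_bigl do rewrite andbC.
  rewrite big_mkcondr; apply: eq_bigr => v /eqP v_m; rewrite word_weight //.
  apply: eq_bigr => b _.
  pose u o := oapp (fun o' : 'I_(m b) => v (tagnat.Rank b o') == (b, true)) false (insub o).
  pose A o := oapp (fun o' : 'I_(m b) => letter_wt b o' (v (tagnat.Rank b o'))) 0 (insub o).
  have uE (o : 'I_(m b)) : u o = (v (tagnat.Rank b o) == (b, true)) by rewrite /u valK.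
  have AE (o : 'I_(m b)) : A o = letter_wt b o (v (tagnat.Rank b o)) by rewrite /A valK.
  transitivity (\prod_(o < m b) (if all u (iota o (m b - o)) then s else A o)).
    apply: eq_bigr => o _; rewrite AE; congr (if _ then _ else _).
    have le_o := ltnW (ltn_ord o); apply/forallP/allP => [H x|H o'].
      rewrite mem_iota subnKC // => /andP[le_ox lt_x].
      by rewrite (uE (Ordinal lt_x)); have /implyP := H (Ordinal lt_x); apply.
    apply/implyP => le_oo'; rewrite -uE; apply: H.
    by rewrite mem_iota le_oo' subnKC // ltn_ord.
  rewrite suffix_expand; apply: eq_bigr => e _; apply: eq_bigr => o _.
  by rewrite /F AE uE.
rewrite (mcoeff_rows fst); congr (_@_m); apply: eq_bigr => b _; apply: eq_bigr => e _.
have le_e : (e <= m b)%N by rewrite -ltnS.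
rewrite -(prod_row_entry s b le_e); apply: eq_bigr => o _.
exact: sum_row_entry.
Qed.
End Rows.

Lemma compat_word_coef (K : comNzRingType) (n N : nat) (t s : K) (m : 'X_{1..N}) :
  mdeg m = n ->
  \sum_(p : 'S_n * {ffun 'I_n -> 'I_N} | compat p.1 p.2 && (content p.2 == m))
     t ^+ exc p.1 * s ^+ fix_ p.1 = word_coef t s m.
Proof. by rewrite mdegE => <-; rewrite compat_sum word_sum. Qed.

Lemma mnm_leq_mdeg (N : nat) (m : 'X_{1..N}) (b : 'I_N) : (m b <= mdeg m)%N.
Proof. by rewrite mdegE (bigD1 b) //= leq_addr. Qed.

Lemma wrow0 (K : comNzRingType) (N : nat) (t : K) (b : 'I_N) M :
  wrow t 0 b M = derow t b M.
Proof.
rewrite /wrow big_ord_recl /= subn0 expr0 mulr1 big1 ?addr0 // => i _.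
by rewrite scale0r expr0n mulr0.
Qed.

Lemma word_coef_conv (K : comNzRingType) (N : nat) (t r : K) (m : 'X_{1..N}) :
  word_coef t r m = \sum_(k : 'X_{1..N < (mdeg m).+1} | (k <= m)%MM)
                      r ^+ mdeg k * word_coef t 0 (m - k)%MM.
Proof.
rewrite {1}/word_coef; set B := (mdeg m).+1.
have lt_mB b : (m b < B)%N by rewrite ltnS mnm_leq_mdeg.
rewrite (prod_sum_leq (fun b e => derow t b (m b - e) * (r *: 'X_b) ^+ e) lt_mB).
rewrite raddf_sum /=.
pose mnm_of (f : {ffun 'I_N -> 'I_B}) : 'X_{1..N} := [multinom nat_of_ord (f b) | b < N].
rewrite (reindex_onto (fun k : 'X_{1..N < B} => [ffun b => inord (k b)] : {ffun _ -> 'I_B})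
                      (fun f => insubd bm0 (mnm_of f))); last first.
  move=> f /forallP le_fm; apply/ffunP => b; rewrite ffunE insubdK ?mnmE ?inord_val //.
  rewrite -topredE /= ltnS !mdegE; apply: leq_sum => a _; rewrite mnmE; exact: le_fm.
have kK (k : 'X_{1..N < B}) b : (inord (k b) : 'I_B) = k b :> nat.
  by rewrite inordK // (leq_ltn_trans (mnm_leq_mdeg k b) (bmdeg k)).
apply: eq_big => [k|k le_km].
  have -> : insubd bm0 (mnm_of [ffun b => inord (k b) : 'I_B]) = k.
    apply: val_inj; rewrite -[RHS]/(val k) (_ : mnm_of _ = val k) ?valKd //.
    by apply/mnmP => b; rewrite mnmE ffunE kK.
  rewrite eqxx andbT; apply/forallP/mnm_lepP => le b; have := le b;
    by rewrite ffunE kK.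
have {}le_km : (k <= m)%MM.
  case/andP: le_km => /forallP le_km _; apply/mnm_lepP => b.
  by have := le_km b; rewrite ffunE kK.
under eq_bigr do rewrite ffunE kK exprZn -scalerAr.
rewrite scaler_prod big_split /= -mpolyXE_id mcoeffZ prodrXr -mdegE.
rewrite (_ : mcoeff m _ = (\prod_b derow t b (m b - k b))@_(m - k)); last first.
  by rewrite -[RHS](mcoeffMX _ k) addmC submK.
congr (_ * _).
by congr (_@__); apply: eq_bigr => b _; rewrite wrow0 mnmBE.
Qed.

Section Homogeneous.
Variables (K : comNzRingType) (N : nat).

Definition hpart (E : 'X_{1..N} -> K) (n : nat) : {mpoly K[N]} :=
  \sum_(m : 'X_{1..N < n.+1}) (if mdeg m == n then E m else 0) *: 'X_[m].

Lemma mcoeff_hpart E n m : (hpart E n)@_m = if mdeg m == n then E m else 0.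
Proof.
have [lt_mn|le_nm] := ltnP (mdeg m) n.+1.
  by rewrite /hpart (mcoeff_mpoly (fun m => if mdeg m == n then E m else 0)).
rewrite gtn_eqF // raddf_sum big1 //= => k _; rewrite mcoeffZ mcoeffX.
case: (bmnm k =P m) => [eq_k|]; rewrite ?mulr0 //.
by move: le_nm; rewrite -eq_k leqNgt bmdeg.
Qed.

Lemma hpart_conv (t r : K) n :
  hpart (word_coef t r) n =
  \sum_(k < n.+1) r ^+ k *: (hpart (fun=> 1) k * hpart (word_coef t 0) (n - k)).
Proof.
apply/mpolyP => m; rewrite mcoeff_hpart raddf_sum /=.
transitivity (\sum_(k : 'X_{1..N < (mdeg m).+1} | (k <= m)%MM) \sum_(i < n.+1)
    r ^+ i * ((hpart (fun=> 1) i)@_k * (hpart (word_coef t 0) (n - i))@_(m - k)%MM));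
  last first.
  rewrite exchange_big; apply: eq_bigr => i _; rewrite mcoeffZ -mulr_sumr.
  by congr (_ * _); apply/esym; apply: mcoeff_poly_mul_lin.
case: ifP => [/eqP deg_m|/eqP deg_m].
  rewrite word_coef_conv; apply: eq_bigr => k le_km.
  have degE : (mdeg m = mdeg k + mdeg (m - k)%MM)%N by rewrite -mdegD addmC submK.
  have lt_k : (mdeg k < n.+1)%N by rewrite ltnS; lia.
  rewrite (bigD1 (Ordinal lt_k)) //= !mcoeff_hpart eqxx mul1r.
  rewrite ifT; last by apply/eqP; lia.
  rewrite big1 ?addr0 // => i neq_i.
  rewrite mcoeff_hpart ifN ?mul0r ?mulr0 //.
  by apply: contraNN neq_i => /eqP eq_i; apply/eqP/val_inj.
apply/esym/big1 => k le_km; apply: big1 => i _; rewrite !mcoeff_hpart.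
have degE : (mdeg m = mdeg k + mdeg (m - k)%MM)%N by rewrite -mdegD addmC submK.
case: eqP => [eq_i|]; rewrite ?mul0r ?mulr0 //.
case: eqP => [eq_ni|]; rewrite ?mulr0 //.
by case: deg_m; have := ltn_ord i; lia.
Qed.
End Homogeneous.

Lemma telescope_prod (R : comNzRingType) (N : nat) (P : pred 'I_N) (z : nat -> R) :
  (forall b : 'I_N, ~~ P b -> z b.+1 = z b) ->
  (\prod_(b < N) if P b then z b.+1 else 1) * z 0%N =
  (\prod_(b < N) if P b then z b else 1) * z N.
Proof.
elim: N P => [|N IH] P zP; first by rewrite !big_ord0.
rewrite !big_ord_recr /= mulrAC (IH (P \o widen_ord (leqnSn N))) => [|b /zP //].
rewrite -!mulrA; congr (_ * _).
by case: ifPn => [//|/zP /= ->]; rewrite mulr1 mul1r.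
Qed.

Section Telescope.
Variables (K : comNzRingType) (N : nat) (t : K).
Implicit Types (b : 'I_N) (M : nat).

Lemma wrowS r b M :
  wrow t r b M.+1 = derow t b M.+1 + (r *: 'X_b) * wrow t r b M.
Proof.
rewrite /wrow big_ord_recl subn0 expr0 mulr1; congr (_ + _).
rewrite mulr_sumr; apply: eq_bigr => e _.
by rewrite /= /bump /= add1n subSS exprS mulrCA.
Qed.

Lemma prod_slot b M : \prod_(o < M.+1) slot t b o = zpol N t b * lpol t b ^+ M.
Proof.
by rewrite big_ord_recl /=; congr (_ * _); rewrite prodr_const card_ord.
Qed.

Lemma wrow1 b M : M != 0%N -> wrow t 1 b M = zpol N t b * lpol t b ^+ M.-1.
Proof.
case: M => // M _; rewrite -prod_slot; elim: M.+1 => [|{}M IH].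
  by rewrite /wrow big_ord1 big_ord0 expr0 mulr1.
by rewrite wrowS IH scale1r /= big_ord_recr /= mulrBr [_ * 'X_b]mulrC subrK.
Qed.

Lemma zpolS b : zpol N t b.+1 = zpol N t b + (t - 1) *: 'X_b.
Proof.
rewrite /zpol [LHS](bigD1 b) //= [in RHS](bigD1 b) //= ltnS leqnn ltnn.
rewrite scalerBl [RHS]addrC addrA subrK; congr (_ + _).
by apply: eq_bigr => a neq_a; rewrite ltnS leq_eqVlt (negbTE neq_a : (a == b :> nat) = false).
Qed.

Lemma wrow_t b M : M != 0%N -> wrow t t b M = zpol N t b.+1 * lpol t b ^+ M.-1.
Proof.
case: M => // M _ /=.
have lpolB : lpol t b - 'X_b = zpol N t b.+1.
  by rewrite zpolS /lpol -addrA scalerBl scale1r.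
elim: M => [|M IH].
  rewrite wrowS /wrow big_ord1 /= big_ord0 expr0 !mulr1 mul1r zpolS scalerBl scale1r.
  by rewrite addrAC -addrA.
rewrite wrowS IH /= prod_slot lpolB.
have -> : lpol t b ^+ M.+1 = (zpol N t b + t *: 'X_b) * lpol t b ^+ M by rewrite exprS.
ring.
Qed.

Lemma zpol0 : zpol N t 0 = \sum_a 'X_a.
Proof. by apply: eq_bigr => a _; rewrite scale1r. Qed.

Lemma zpolN : zpol N t N = t *: \sum_a 'X_a.
Proof. by rewrite scaler_sumr; apply: eq_bigr => a _; rewrite ltn_ord. Qed.
End Telescope.

Section Support.
Variables (K : idomainType) (N : nat) (m : 'X_{1..N}).

                                                                             
                                                        
Definition kill (a : 'I_N) : {mpoly K[N]} := if m a == 0%N then 0 else 'X_a.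

Lemma mcoeff_kill (p : {mpoly K[N]}) : (mmap (@mpolyC N K) kill p)@_m = p@_m.
Proof.
rewrite [in RHS](mpolyE p) /mmap !raddf_sum /=; apply: eq_bigr => k _.
rewrite mcoeffCM mcoeffZ mpolyXE_id; congr (_ * _).
have [/existsP[a /andP[/eqP ma ka]]|] := boolP [exists a, (m a == 0%N) && (0 < k a)%N].
  rewrite /mmap1 -mpolyXE_id mcoeffX (bigD1 a) //= {1}/kill ma eqxx expr0n.
  rewrite eqn0Ngt ka mul0r mcoeff0; case: eqP => // eq_k.
  by rewrite eq_k ma in ka.
rewrite negb_exists => /forallP no_a; congr (_@_m); apply: eq_bigr => a _.
rewrite /kill; have := no_a a; case: eqP => //= _; rewrite -eqn0Ngt => /eqP ->.
by rewrite !expr0.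
Qed.

Lemma word_coef_t (t : K) : m != 0%MM -> word_coef t t m = t * word_coef t 1 m.
Proof.
move=> m_neq0; rewrite /word_coef -mcoeffZ.
rewrite -[LHS]mcoeff_kill -[RHS]mcoeff_kill; congr (_@_m).
pose rho : {rmorphism {mpoly K[N]} -> {mpoly K[N]}} := mmap (@mpolyC N K) kill.
rewrite -![mmap _ kill _]/(rho _); pose z b := rho (zpol N t b).
have rhoX (b : 'I_N) : rho 'X_b = kill b by rewrite /= mmapX mmap1U.
have rhoZ c p : rho (c *: p) = c%:MP * rho p by rewrite /= mmapZ.
have zS (b : 'I_N) : m b = 0%N -> z b.+1 = z b.
  by move=> mb; rewrite /z zpolS rmorphD rhoZ rhoX /kill mb eqxx mulr0 addr0.
pose Y := rho (\sum_a 'X_a).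
have Y_neq0 : Y != 0.
  have [a ma] : exists a, m a != 0%N.
    apply/existsP; rewrite -negb_forall; apply: contraNN m_neq0 => /forallP m0.
    by apply/eqP/mnmP => a; rewrite mnm0E; apply/eqP.
  apply/eqP => /(congr1 (mcoeff U_(a))); rewrite /Y rmorph_sum raddf_sum mcoeff0.
  rewrite (bigD1 a) //= rhoX /kill (negbTE ma) mcoeffXU eqxx big1 ?addr0.
    by apply/eqP; rewrite oner_eq0.
  move=> b neq_ba; rewrite rhoX /kill; case: ifP => _; rewrite ?mcoeff0 //.
  by rewrite mcoeffXU (negbTE neq_ba).
have tele := @telescope_prod _ N (fun b => m b != 0%N) z (fun b mb => zS b (eqP (negbNE mb))).
have prodE r (h : 'I_N -> {mpoly K[N]}) :
    (forall b, m b != 0%N -> wrow t r b (m b) = h b * lpol t b ^+ (m b).-1) ->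
    rho (\prod_b wrow t r b (m b)) =
    (\prod_(b < N) if m b != 0%N then rho (h b) else 1) *
    \prod_b rho (lpol t b ^+ (m b).-1).
  move=> rowE; rewrite rmorph_prod -big_split; apply: eq_bigr => b _.
  case: ifPn => [mb|]; last first.
    have row0 : wrow t r b 0 = 1 by rewrite /wrow big_ord1 expr0 mulr1.
    by rewrite negbK => /eqP ->; rewrite row0 expr0 !rmorph1; apply/esym/mulr1.
  by rewrite rowE // rmorphM.
rewrite rhoZ (prodE _ _ (fun b => @wrow1 _ _ t b _)) (prodE _ _ (fun b => @wrow_t _ _ t b _)).
rewrite mulrA; congr (_ * _).
apply: (mulIf Y_neq0); move: tele.
rewrite /z zpol0 zpolN rhoZ -/Y => ->.
by rewrite mulrCA mulrA.
Qed.
End Support.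

Lemma mdeg_content (n N : nat) (f : 'I_n -> 'I_N) : mdeg (content f) = n.
Proof.
rewrite mdegE -[RHS]card_ord -sum1_card (partition_big f xpredT) //=.
by apply: eq_bigr => b _; rewrite mnmE -sum1_card; apply: eq_bigl => i; rewrite inE.
Qed.

Lemma prod_content (K : comNzRingType) (n N : nat) (f : 'I_n -> 'I_N) (x : 'I_N -> K) :
  \prod_i x (f i) = \prod_b x b ^+ content f b.
Proof.
rewrite (partition_big f xpredT) //=; apply: eq_bigr => b _.
rewrite mnmE -prodr_const; apply: eq_big => [i|i /eqP -> //].
by rewrite inE.
Qed.

Lemma compat_gf (K : comNzRingType) (n N : nat) (t s : K) (x : 'I_N -> K) :
  \sum_(sigma : 'S_n) t ^+ exc sigma * s ^+ fix_ sigma *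
     (\sum_(c : {ffun 'I_n -> 'I_N} | compat sigma c) \prod_i x (c i)) =
  (hpart (word_coef t s) n).@[x].
Proof.
under eq_bigr do rewrite mulr_sumr.
rewrite (pair_big_dep xpredT (@compat n N)
  (fun sigma c => t ^+ exc sigma * s ^+ fix_ sigma * \prod_i x (c i))) /=.
have lt_content (c : {ffun 'I_n -> 'I_N}) : (mdeg (content c) < n.+1)%N.
  by rewrite mdeg_content.
rewrite (partition_big (fun p => BMultinom (lt_content p.2)) xpredT) //=.
rewrite /hpart raddf_sum /=; apply: eq_bigr => m _; rewrite mevalZ mevalX.
case: eqP => [deg_m|deg_m].
  rewrite -(compat_word_coef _ _ deg_m) mulr_suml; apply: eq_big => [p|p /andP[_]].
    by rewrite bmeqP.
  by rewrite bmeqP => /eqP /= <-; rewrite prod_content.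
rewrite mul0r big1 // => p /andP[_]; rewrite bmeqP /= => /eqP eq_m.
by case: deg_m; rewrite -eq_m mdeg_content.
Qed.

Lemma homo_ord (n : nat) (r : rel nat) (F : 'I_n -> nat) : transitive r ->
  (forall i j : 'I_n, j = i.+1 :> nat -> r (F i) (F j)) ->
  forall i j : 'I_n, (i < j)%N -> r (F i) (F j).
Proof.
move=> r_trans adj i j; move eq_k : (nat_of_ord j) => k.
elim: k j eq_k => // k IH j eq_j; rewrite ltnS leq_eqVlt => /orP[/eqP eq_i|lt_ik].
  by apply: adj; rewrite eq_j eq_i.
have lt_kn : (k < n)%N by rewrite -ltnS -eq_j ltnS ltnW // ltn_ord.
exact: r_trans (IH (Ordinal lt_kn) erefl lt_ik) (adj (Ordinal lt_kn) j eq_j).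
Qed.

Definition steps (n N : nat) (D : nat -> bool) (c : {ffun 'I_n -> 'I_N}) : bool :=
  [forall i : 'I_n, forall j : 'I_n, (j == i.+1 :> nat) ==> (c i + D i <= c j)%N].

Definition dex_pred (n : nat) (sigma : 'S_n) (k : nat) : bool :=
  [exists i : 'I_n, (i == k :> nat) && (i \in DEX sigma)].

Lemma dex_predE (n : nat) (sigma : 'S_n) (i : 'I_n) : dex_pred sigma i = (i \in DEX sigma).
Proof.
apply/existsP/idP => [[j /andP[/eqP/val_inj -> //]]|Di].
by exists i; rewrite eqxx.
Qed.

Lemma compat_steps (n N : nat) (sigma : 'S_n) (c : {ffun 'I_n -> 'I_N}) :
  compat sigma c = steps (dex_pred sigma) c.
Proof.
have keyE (i j : 'I_n) : j = i.+1 :> nat ->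
    (compat_key sigma c i < compat_key sigma c j)%N = (c i + dex_pred sigma i <= c j)%N.
  move=> eq_j; have jE : j = ordS i.
    by apply: val_inj; rewrite /= -eq_j modn_small.
  rewrite dex_predE inE -eq_j ltn_ord -jE andTb /dex_key !lex_ltn // double_bool_ltn double_bool_eq.
  have neq : sigma i != sigma j :> nat.
    by rewrite val_eqE (inj_eq perm_inj); apply/eqP => eq_ij; rewrite eq_ij in eq_j; lia.
  case: (ltngtP (c i) (c j)) => [lt_c|lt_c|->] /=.
  - by apply/esym; move: (X in (_ + nat_of_bool X)%N) => ?; lia.
  - by apply/esym; move: (X in (_ + nat_of_bool X)%N) => ?; lia.
  case: (sigma i <= i)%N; case: (sigma j <= j)%N => /=; case: (ltngtP (sigma i) (sigma j)) neq => //= _ _;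
    by rewrite ?addn0 ?addn1 ?leqnn //; lia.
apply/forallP/forallP => H i.
  apply/forallP => j; apply/implyP => /eqP eq_j; rewrite -keyE //.
  by have /forallP/(_ j)/implyP := H i; apply; rewrite eq_j.
apply/forallP => j; apply/implyP; apply: (homo_ord ltn_trans) => {}i {}j eq_j.
by rewrite keyE //; have /forallP/(_ j)/implyP := H i; apply; rewrite eq_j.
Qed.

Section ChainSum.
Variables (K : fieldType) (q : K) (D : nat -> bool).

Section Recursion.
Variable N : nat.

Definition chain_sum (n M : nat) : K :=
  \sum_(c : {ffun 'I_n -> 'I_N} | steps D c && [forall i, (c i < M)%N])
     \prod_i q ^+ (M.-1 - c i).

Definition push n (p : 'I_N * {ffun 'I_n -> 'I_N}) : {ffun 'I_n.+1 -> 'I_N} :=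
  [ffun i => oapp p.2 p.1 (unlift ord_max i)].

Definition pop n (c : {ffun 'I_n.+1 -> 'I_N}) : 'I_N * {ffun 'I_n -> 'I_N} :=
  (c ord_max, [ffun i => c (lift ord_max i)]).

Lemma push_max n p : @push n p ord_max = p.1.
Proof. by rewrite ffunE unlift_none. Qed.

Lemma push_lift n p i : @push n p (lift ord_max i) = p.2 i.
Proof. by rewrite ffunE liftK. Qed.

Lemma pushK n : cancel (@push n) (@pop n).
Proof.
move=> [a c]; rewrite /pop push_max; congr pair; apply/ffunP => i.
by rewrite ffunE push_lift.
Qed.

Lemma popK n : cancel (@pop n) (@push n).
Proof.
move=> c; apply/ffunP => i; case: (unliftP ord_max i) => [j ->|->].
  by rewrite push_lift ffunE.
by rewrite push_max.
Qed.

Lemma steps_push n a (c : {ffun 'I_n -> 'I_N}) :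
  steps D (push (a, c)) =
  steps D c && [forall i : 'I_n, (i.+1 == n) ==> (c i + D i <= a)%N].
Proof.
apply/forallP/andP => [H|[/forallP stepc /forallP last_c] i].
  split; apply/forallP => i.
    apply/forallP => j; apply/implyP => eq_j.
    have /forallP/(_ (lift ord_max j))/implyP := H (lift ord_max i).
    by rewrite !push_lift !lift_max; apply.
  apply/implyP => /eqP eq_i.
  have /forallP/(_ ord_max)/implyP := H (lift ord_max i).
  by rewrite push_lift push_max lift_max eq_i; apply.
apply/forallP => j; apply/implyP.
case: (unliftP ord_max i) => [i' ->|->]; last first.
  by move=> /eqP /= eq_j; have := ltn_ord j; rewrite eq_j ltnn.
rewrite push_lift lift_max; case: (unliftP ord_max j) => [j' ->|->].
  by rewrite push_lift lift_max => eq_j; have /forallP/(_ j')/implyP := stepc i'; apply.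
by rewrite push_max /= eq_sym => eq_i; have /implyP := last_c i'; apply.
Qed.

Lemma steps_last n (a : nat) (c : {ffun 'I_n -> 'I_N}) : steps D c ->
  [forall i : 'I_n, (i.+1 == n) ==> (c i + D i <= a)%N] =
  [forall i : 'I_n, (c i < a.+1 - D n.-1)%N].
Proof.
move=> /forallP stepc; apply/forallP/forallP => [last_c i|lt_c i]; last first.
  apply/implyP => /eqP eq_i; have := lt_c i.
  by rewrite -(congr1 predn eq_i) /=; lia.
have lt_n : (n.-1 < n)%N by have := ltn_ord i; lia.
pose l := Ordinal lt_n.
have le_il : (c i <= c l)%N.
  have [eq_il|lt_il] : i = l \/ (i < l)%N.
    have : (i <= l)%N by have := ltn_ord i => /=; lia.
    by rewrite leq_eqVlt => /orP[/eqP/val_inj|]; [left | right].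
  - by rewrite eq_il.
  apply: (homo_ord leq_trans (F := fun i => c i)) lt_il => {}i j eq_j.
  have /forallP/(_ j)/implyP := stepc i; rewrite eq_j => /(_ (eqxx _)).
  by apply: leq_trans; apply: leq_addr.
have /implyP := last_c l; rewrite /= prednK ?eqxx; last by lia.
by move/(_ isT); lia.
Qed.

Lemma chain_sum0 M : chain_sum 0 M = 1.
Proof.
rewrite /chain_sum (eq_bigl xpredT) => [|c]; last first.
  by apply/andP; split; apply/forallP => -[].
rewrite (eq_bigr (fun=> 1)) => [|c _]; last by rewrite big_ord0.
by rewrite sumr_const card_ffun !card_ord.
Qed.

Lemma chain_sumS n M : (M <= N)%N ->
  chain_sum n.+1 M =
  \sum_(a < M) q ^+ ((M.-1 - a) * n.+1 + D n.-1 * n) * chain_sum n (a.+1 - D n.-1).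
Proof.
move=> le_MN; rewrite /chain_sum (reindex (@push n)) /=; last first.
  by apply: onW_bij; exists (@pop n); [exact: pushK | exact: popK].
rewrite (big_ord_widen N (fun a => q ^+ ((M.-1 - a) * n.+1 + D n.-1 * n) *
                                   chain_sum n (a.+1 - D n.-1))) //.
under [RHS]eq_bigr do rewrite /chain_sum mulr_sumr.
rewrite (pair_big_dep (fun a : 'I_N => (a < M)%N)) /=; apply: eq_big => [[a c]|[a c]] /=.
  rewrite steps_push; case: (boolP (steps D c)) => [stepc|]; last by rewrite andbF.
  rewrite /= steps_last // andbC.
  case: (boolP [forall i : 'I_n, (c i < a.+1 - D n.-1)%N]) => [/forallP lt_c|];
    last by rewrite !andbF.
  rewrite !andbT; apply/forallP/idP => [lt_M|lt_aM i].
    by have := lt_M ord_max; rewrite push_max.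
  case: (unliftP ord_max i) => [j ->|->]; rewrite ?push_max // push_lift /=.
  by have := lt_c j; lia.
rewrite steps_push => /andP[/andP[stepc last_c] /forallP lt_M].
have lt_aM : (a < M)%N by have := lt_M ord_max; rewrite push_max.
move: last_c; rewrite steps_last // => /forallP lt_c.
rewrite big_ord_recr /= push_max /=.
transitivity ((\prod_(i < n) q ^+ (((M.-1 - a) + D n.-1) + ((a.+1 - D n.-1).-1 - c i)))
              * q ^+ (M.-1 - a)).
  congr (_ * _); apply: eq_bigr => i _.
  have -> : widen_ord (leqnSn n) i = lift ord_max i by apply: ord_inj; rewrite lift_max.
  by rewrite push_lift /=; have := lt_c i => lt_ci; congr (_ ^+ _); lia.
under [X in X * _ = _]eq_bigr do rewrite exprD.
rewrite big_split /= prodr_const card_ord -exprM mulrAC -exprD.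
by congr (_ ^+ _ * _); lia.
Qed.
End Recursion.

                                                                                    
                   
Fixpoint chain_poly (n : nat) : {poly K} :=
  if n is n'.+1 then
    \sum_(j < n'.+1)
      (q ^+ (D n'.-1 * n') * (chain_poly n')`_j * q ^- (j * D n'.-1) / (1 - q ^+ (n'.+1 - j)))
        *: ('X^j - 'X^(n'.+1))
  else 1.

Hypotheses (q_neq0 : q != 0) (q_pow : forall i, (0 < i)%N -> q ^+ i != 1).

Lemma size_chain_poly n : (size (chain_poly n) <= n.+1)%N.
Proof.
case: n => [|n] /=; first by rewrite size_poly1.
apply: (leq_trans (size_sum _ _ _)); apply/bigmax_leqP => j _.
apply: (leq_trans (size_scale_leq _ _)); apply: (leq_trans (size_polyD _ _)).
by rewrite size_polyN !size_polyXn geq_max !ltnS leqnn andbT ltnW.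
Qed.

Lemma sum_geom_mixed n M j : (j <= n)%N ->
  \sum_(a < M) q ^+ ((M.-1 - a) * n.+1) * q ^+ (a.+1 * j) =
  (q ^+ (M * j) - q ^+ (M * n.+1)) / (1 - q ^+ (n.+1 - j)).
Proof.
move=> le_jn; have nz : 1 - q ^+ (n.+1 - j) != 0.
  by rewrite subr_eq0 eq_sym q_pow // subn_gt0 ltnS.
apply: (mulIf nz); rewrite divfK // (reindex_inj rev_ord_inj) /=.
transitivity (q ^+ (M * j) * (\sum_(a < M) (q ^+ (n.+1 - j)) ^+ a) * (1 - q ^+ (n.+1 - j))).
  congr (_ * _); rewrite mulr_sumr; apply: eq_bigr => a _.
  have lt_a := ltn_ord a; rewrite -exprM -!exprD; congr (_ ^+ _).
  have -> : (M.-1 - (M - a.+1))%N = a by lia.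
  have -> : (M - a.+1).+1 = (M - a)%N by lia.
  rewrite mulnBl mulnBl.
  have : (a * j <= M * j)%N by rewrite leq_mul2r (ltnW lt_a) orbT.
  have : (j * a <= n.+1 * a)%N by rewrite leq_mul2r leqW ?orbT.
  by rewrite (mulnC j a) (mulnC n.+1 a); lia.
rewrite -mulrA [X in _ * X]mulrC -opprB mulNr -subrX1 mulrN -exprM mulrBr mulr1 -exprD opprB.
by rewrite (mulnC M j) -mulnDl subnKC ?leqW // (mulnC M).
Qed.
Lemma chain_sum_poly N n M : (M <= N)%N -> chain_sum N n M = (chain_poly n).[q ^+ M].
Proof.
elim: n M => [|n IH] M le_MN; first by rewrite chain_sum0 hornerC.
rewrite chain_sumS //= horner_sum.
transitivity (\sum_(a < M) \sum_(j < n.+1) q ^+ (D n.-1 * n) * (chain_poly n)`_j *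
    q ^- (j * D n.-1) * (q ^+ ((M.-1 - a) * n.+1) * q ^+ (a.+1 * j))).
  apply: eq_bigr => a _; rewrite IH; last by have := ltn_ord a; lia.
  rewrite (horner_coef_wide _ (size_chain_poly n)) mulr_sumr; apply: eq_bigr => j _.
  rewrite exprD -!exprM.
  have -> : q ^+ (a.+1 * j) = q ^+ ((a.+1 - D n.-1) * j) * q ^+ (j * D n.-1).
    by rewrite -exprD mulnBl (mulnC j) subnK // leq_mul2r; case: (D _); rewrite orbT.
  have : q ^+ (j * D n.-1) != 0 by rewrite expf_neq0.
  move: (q ^+ (j * D n.-1)) => u u_neq0.
  by move: (q ^+ _) (q ^+ _) (q ^+ _) => x y z; field.
rewrite exchange_big; apply: eq_bigr => j _ /=.
rewrite -mulr_sumr sum_geom_mixed; last by rewrite -ltnS.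
rewrite hornerZ hornerD hornerN !hornerXn -!exprM.
by rewrite -!mulrA; do 3!congr (_ * _); rewrite mulrC.
Qed.

Lemma chain_poly0 n : (chain_poly n).[0] * \prod_(i < n) (1 - q ^+ i.+1) =
  q ^+ (\sum_(i < n) D i.-1 * i).
Proof.
elim: n => [|n IH]; first by rewrite !big_ord0 hornerC mulr1.
rewrite !big_ord_recr exprD -IH /= horner_sum big_ord_recl big1 => [|j _].
  rewrite hornerZ hornerD hornerN !hornerXn !expr0n /= subr0 mulr1 mul0n expr0 invr1 mulr1.
  rewrite -horner_coef0 addr0 subn0.
  have nz : 1 - q ^+ n.+1 != 0 by rewrite subr_eq0 eq_sym q_pow.
  by field.
by rewrite hornerZ hornerD hornerN !hornerXn !expr0n subr0 mulr0.
Qed.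
End ChainSum.

Lemma sum_dex_pred (n : nat) (sigma : 'S_n) :
  (\sum_(i < n) dex_pred sigma i.-1 * i = dexsum sigma)%N.
Proof.
rewrite /dexsum [RHS]big_mkcond; case: n sigma => [|n] sigma; first by rewrite !big_ord0.
rewrite big_ord_recl [RHS]big_ord_recr /= muln0 add0n inE ltnn /= addn0.
apply: eq_bigr => i _; rewrite /bump /= add1n (dex_predE sigma (widen_ord (leqnSn n) i)).
by case: ifP => _; rewrite ?mul1n ?mul0n.
Qed.

Lemma exc1 (n : nat) : exc (1%g : 'S_n) = 0%N.
Proof. by rewrite exc_sum big1 // => i _; rewrite perm1 ltnn. Qed.

Lemma exc_eq0 (n : nat) (sigma : 'S_n) : exc sigma = 0%N -> sigma = 1%g.
Proof.
rewrite exc_sum => /eqP; rewrite sum_nat_eq0 => /forallP exc0.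
have le_sigma i : (sigma i <= i)%N by have := exc0 i; rewrite /= eqb0 -leqNgt.
have : (\sum_(i < n) (i - sigma i) == 0)%N.
  by rewrite sumnB // [X in (X - _)%N](reindex_inj (@perm_inj _ sigma)) subnn.
rewrite sum_nat_eq0 => /forallP sub0; apply/permP => i; rewrite perm1.
apply/val_inj/eqP; rewrite eqn_leq le_sigma -subn_eq0.
by have := sub0 i.
Qed.

Lemma dexsum1 (n : nat) : dexsum (1%g : 'S_n) = 0%N.
Proof.
rewrite /dexsum big_pred0 // => i; rewrite inE; apply/negbTE/negP => /andP[lt_i].
by rewrite /dex_key !perm1 !leqnn val_ordS // ltn_add2l ltnNge leqnSn.
Qed.

Lemma poly_eq_infinite (K : idomainType) (f : nat -> K) (p r : {poly K}) :
  injective f -> (forall i, p.[f i] = r.[f i]) -> p = r.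
Proof.
move=> f_inj eq_pr; apply/eqP; rewrite -subr_eq0; apply/negPn/negP => neq0.
have := max_poly_roots neq0 (rs := map f (iota 0 (size (p - r)))).
rewrite size_map size_iota ltnn => H; apply: notF; apply: H.
  by apply/allP => _ /mapP[i _ ->]; rewrite rootE hornerD hornerN eq_pr subrr.
by rewrite map_inj_uniq // iota_uniq.
Qed.

Definition dexpoly (K : nzRingType) (n : nat) (t s : K) : {poly K} :=
  \sum_(sigma : 'S_n) (t ^+ exc sigma * s ^+ fix_ sigma) *: 'X^(dexsum sigma).

Definition qpoch (K : nzRingType) (q : K) (n : nat) : K := \prod_(i < n) (1 - q ^+ i.+1).

Lemma dexpoly_01 (K : nzRingType) (n : nat) : dexpoly n (0 : K) 1 = 1.
Proof.
rewrite /dexpoly (bigD1 1%g) //= exc1 dexsum1 expr0 expr1n mulr1 scale1r big1 ?addr0 //.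
move=> sigma neq1; rewrite expr1n mulr1 expr0n.
case: eqP => [/exc_eq0 eq1|]; last by rewrite scale0r.
by rewrite eq1 eqxx in neq1.
Qed.

Lemma word_coef_01 (K : idomainType) (N : nat) (m : 'X_{1..N}) : word_coef (0 : K) 1 m = 1.
Proof.
rewrite word_coef_conv (bigD1 (BMultinom (ltnSn (mdeg m)))) /=; last exact: lepm_refl.
have -> : (m - m)%MM = 0%MM by apply/mnmP => b; rewrite mnmBE mnm0E subnn.
rewrite expr1n mul1r big1 => [|k /andP[le_km neq_km]].
  rewrite addr0 /word_coef big1 ?mcoeff1 ?eqxx // => b _.
  by rewrite mnm0E wrow0.
rewrite word_coef_t ?mul0r ?mulr0 //; apply: contraNN neq_km => /eqP sub0.
by rewrite bmeqP /=; apply/eqP; rewrite -[RHS](submK le_km) sub0 add0m.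
Qed.

Lemma hpart_t (K : idomainType) (N n : nat) (t : K) : (0 < n)%N ->
  hpart (word_coef t t) n = t *: hpart (N := N) (word_coef t 1) n.
Proof.
move=> n_gt0; apply/mpolyP => m.
rewrite [LHS]mcoeff_hpart.
rewrite [RHS]mcoeffZ.
rewrite [X in t * X]mcoeff_hpart.
case: eqP => [deg_m|_]; last by rewrite mulr0.
by rewrite word_coef_t // -mdeg_eq0 deg_m -lt0n.
Qed.

Section Specialize.
Variables (K : fieldType) (q : K).
Hypotheses (q_neq0 : q != 0) (q_pow : forall i, (0 < i)%N -> q ^+ i != 1).

                                                                          
Let gpoly n t s : {poly K} :=
  \sum_(sigma : 'S_n) (t ^+ exc sigma * s ^+ fix_ sigma) *: chain_poly q (dex_pred sigma) n.

Let gpoly_eval n t s N : (gpoly n t s).[q ^+ N] =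
  (hpart (word_coef t s) n).@[fun a : 'I_N => q ^+ (N.-1 - a)].
Proof.
rewrite -compat_gf horner_sum; apply: eq_bigr => sigma _; rewrite hornerZ; congr (_ * _).
rewrite -(chain_sum_poly _ q_neq0 q_pow _ (leqnn N)) //; apply: eq_bigl => c.
by rewrite compat_steps andb_idr // => _; apply/forallP => i.
Qed.

Let gpoly_0 n t s : (gpoly n t s).[0] * qpoch q n = (dexpoly n t s).[q].
Proof.
rewrite !horner_sum mulr_suml; apply: eq_bigr => sigma _.
by rewrite !hornerZ -mulrA chain_poly0 // hornerXn sum_dex_pred.
Qed.

Let q_inj : injective (fun N => q ^+ N).
Proof.
have lt_neq i j : (i < j)%N -> q ^+ i != q ^+ j.
  move=> lt_ij; rewrite -(subnKC (ltnW lt_ij)) exprD -{1}[q ^+ i]mulr1.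
  by rewrite (inj_eq (mulfI (expf_neq0 i q_neq0))) eq_sym q_pow // subn_gt0.
by move=> i j /eqP; case: (ltngtP i j) => // /lt_neq; [|rewrite eq_sym] => /negbTE ->.
Qed.

Let qpoch_neq0 n : qpoch q n != 0.
Proof. by apply/prodf_neq0 => i _; rewrite subr_eq0 eq_sym q_pow. Qed.

Lemma dexpoly_conv_at n t r :
  (dexpoly n t r).[q] = \sum_(k < n.+1) r ^+ k *
    (qpoch q n / (qpoch q k * qpoch q (n - k))) * (dexpoly (n - k) t 0).[q].
Proof.
have -> : (dexpoly n t r).[q] = (gpoly n t r).[0] * qpoch q n by rewrite gpoly_0.
have -> : gpoly n t r = \sum_(k < n.+1) r ^+ k *: (gpoly k 0 1 * gpoly (n - k) t 0).
  apply: (poly_eq_infinite q_inj) => N; rewrite gpoly_eval hpart_conv horner_sum raddf_sum /=.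
  apply: eq_bigr => k _; rewrite hornerZ hornerM mevalZ mevalM !gpoly_eval.
  by congr (_ * (_.@[_] * _)); apply: eq_bigr => m _; rewrite word_coef_01.
rewrite horner_sum mulr_suml; apply: eq_bigr => k _.
rewrite hornerZ hornerM -[(dexpoly _ t 0).[q]]gpoly_0.
have : (gpoly k 0 1).[0] = (qpoch q k)^-1.
  by apply: (mulIf (qpoch_neq0 k)); rewrite gpoly_0 dexpoly_01 hornerC mulVf.
move=> ->; have := qpoch_neq0 k; have := qpoch_neq0 (n - k).
by move=> ? ?; field; apply/andP.
Qed.

Lemma dexpoly_t_at n t : (0 < n)%N -> (dexpoly n t t).[q] = t * (dexpoly n t 1).[q].
Proof.
move=> n_gt0; rewrite -!gpoly_0 mulrA -hornerZ; congr (_.[0] * _).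
apply: (poly_eq_infinite q_inj) => N; rewrite hornerZ !gpoly_eval hpart_t //.
exact: mevalZ.
Qed.
End Specialize.

Fixpoint qbin (K : nzRingType) (n k : nat) : {poly K} :=
  match n, k with
  | _, 0 => 1
  | 0, _.+1 => 0
  | n'.+1, k'.+1 => qbin K n' k' + 'X^k * qbin K n' k
  end.

Section QBinomial.
Variable K : comNzRingType.
Implicit Type q : K.

Lemma qbin0 n : qbin K n 0 = 1. Proof. by case: n. Qed.

Lemma qbinS n k : qbin K n.+1 k.+1 = qbin K n k + 'X^(k.+1) * qbin K n k.+1.
Proof. by []. Qed.

Lemma qbin_small n k : (n < k)%N -> qbin K n k = 0.
Proof.
elim: n k => [|n IH] [|k] //= lt_nk.
by rewrite !IH ?mulr0 ?addr0 // ltnW.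
Qed.

Lemma qbinn n : qbin K n n = 1.
Proof. by elim: n => //= n ->; rewrite qbin_small // mulr0 addr0. Qed.

Lemma qpochS q n : qpoch q n.+1 = qpoch q n * (1 - q ^+ n.+1).
Proof. by rewrite /qpoch big_ord_recr. Qed.

Lemma qbin_qpoch q n k : (k <= n)%N ->
  (qbin K n k).[q] * (qpoch q k * qpoch q (n - k)) = qpoch q n.
Proof.
have qpoch0 : qpoch q 0 = 1 by rewrite /qpoch big_ord0.
elim: n k => [|n IH] [|k] le_kn; rewrite ?qbin0 ?hornerC ?qpoch0 ?subn0 ?mul1r ?mul1r //.
have [lt_kn|le_nk] := ltnP k n; last first.
  have -> : k = n by apply/eqP; rewrite eqn_leq le_nk andbT.
  by rewrite qbinn hornerC subnn qpoch0 mul1r mulr1.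
rewrite qbinS hornerD hornerM hornerXn mulrDl subSS [in RHS]qpochS.
have E1 := IH k (ltnW lt_kn); have E2 := IH k.+1 lt_kn.
transitivity (qpoch q n * (1 - q ^+ k.+1) + q ^+ k.+1 * (1 - q ^+ (n - k)) * qpoch q n).
  congr (_ + _); first by rewrite -E1 qpochS; ring.
  have nk : (n - k)%N = (n - k.+1).+1 by lia.
  by rewrite -E2 nk (qpochS _ (n - k.+1)); ring.
have -> : q ^+ n.+1 = q ^+ k.+1 * q ^+ (n - k) by rewrite -exprD addSn subnKC // ltnW.
ring.
Qed.

Lemma qbin_vandermonde r n k : qbin K (r + n) k =
  \sum_(i < r.+1 | (i <= k)%N) qbin K r i * 'X^((r - i) * (k - i)) * qbin K n (k - i).
Proof.
elim: r k => [|r IH] k.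
  by rewrite big_mkcond big_ord1 leq0n sub0n mul0n expr0 qbin0 !mul1r subn0.
case: k => [|k].
  rewrite qbin0 big_mkcond big_ord_recl big1 //=.
  by rewrite !qbin0 muln0 expr0 !mulr1 addr0.
rewrite addSn qbinS !IH.
transitivity ('X^(r.+1 * k.+1) * qbin K n k.+1 + \sum_(i < r.+1) (if (i <= k)%N then
    qbin K r.+1 i.+1 * 'X^((r - i) * (k - i)) * qbin K n (k - i) else 0)); last first.
  by rewrite [RHS]big_mkcond [RHS]big_ord_recl leq0n qbin0 mul1r !subn0; congr (_ + _).
have -> : \sum_(i < r.+1) (if (i <= k)%N then
      qbin K r.+1 i.+1 * 'X^((r - i) * (k - i)) * qbin K n (k - i) else 0) =
    \sum_(i < r.+1) (if (i <= k)%N then qbin K r i * 'X^((r - i) * (k - i)) * qbin K n (k - i) else 0)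
    + \sum_(i < r.+1) (if (i <= k)%N then
        'X^(i.+1) * qbin K r i.+1 * 'X^((r - i) * (k - i)) * qbin K n (k - i) else 0).
  rewrite -big_split /=; apply: eq_bigr => i _; case: ifP => _; last by rewrite addr0.
  by rewrite !mulrDl.
rewrite addrCA big_mkcond; congr (_ + _).
rewrite big_mkcond big_ord_recl leq0n mulrDr; congr (_ + _).
  by rewrite qbin0 mul1r !subn0 mulrA -exprD -mulSn.
rewrite [RHS]big_ord_recr /= qbin_small // mulr0 !mul0r if_same addr0 mulr_sumr.
apply: eq_bigr => i _; rewrite /bump /= add1n ltnS subSS; case: ifP => le_ik; last by rewrite mulr0.
rewrite !mulrA; congr (_ * _); rewrite mulrAC [RHS]mulrAC -!exprD.
congr ('X^_ * _); have := subnSK (ltn_ord i); move: (r - i.+1)%N => x <-.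
by rewrite mulSn; lia.
Qed.
End QBinomial.

Section RootOfUnity.
Variables (K : fieldType) (d : nat) (w : K).
Hypothesis w_prim : d.-primitive_root w.

Let d_gt0 : (0 < d)%N := prim_order_gt0 w_prim.

Lemma qbin_prim_eq0 i : (0 < i < d)%N -> (qbin K d i).[w] = 0.
Proof.
move=> /andP[i_gt0 lt_id]; have := qbin_qpoch w (ltnW lt_id).
have poch_d : qpoch w d = 0.
  by rewrite -(prednK d_gt0) qpochS prednK // prim_expr_order // subrr mulr0.
have poch_neq0 j : (j < d)%N -> qpoch w j != 0.
  move=> lt_jd; apply/prodf_neq0 => l _; rewrite subr_eq0 eq_sym -(prim_order_dvd w_prim).
  by rewrite gtnNdvd // (leq_ltn_trans (ltn_ord l) lt_jd).
rewrite poch_d => /eqP; rewrite mulf_eq0 => /orP[/eqP //|].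
by rewrite mulf_eq0 !(negbTE (poch_neq0 _ _)) //; lia.
Qed.

Lemma qbin_prim_addl n k : (qbin K (d + n) k).[w] =
  (qbin K n k).[w] + (if (d <= k)%N then (qbin K n (k - d)).[w] else 0).
Proof.
rewrite qbin_vandermonde horner_sum big_mkcond (bigD1 ord0) //=.
rewrite (bigD1 ord_max) /=; last by rewrite -val_eqE /= -lt0n.
rewrite [X in _ + (_ + X)]big1 => [|i /andP[i_neq0 i_neqd]]; last first.
  case: ifP => // _; rewrite !hornerM qbin_prim_eq0 ?mul0r // lt0n.
  have := ltn_ord i; rewrite ltnS leq_eqVlt (negbTE (i_neqd : i != d :> nat)) /= => ->.
  by rewrite andbT; exact: i_neq0.
rewrite addr0 qbinn subnn mul0n expr0 qbin0 !mul1r !subn0; congr (_ + _).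
by rewrite hornerM hornerXn exprM (prim_expr_order w_prim) expr1n mul1r.
Qed.

Lemma qbin_prim_mull a k :
  (qbin K (d * a) k).[w] = if (d %| k)%N then 'C(a, k %/ d)%:R else 0.
Proof.
elim: a k => [|a IH] k.
  rewrite muln0 /=; case: k => [|k]; first by rewrite hornerC dvdn0 div0n.
  rewrite hornerC; case: ifP => // /dvdnP[[|e] kE] //.
  by rewrite kE mulnK // bin0n.
rewrite mulnS qbin_prim_addl !IH; case: (leqP d k) => [le_dk|lt_kd]; last first.
  rewrite addr0; case: ifP => // /dvdnP[[|e] kE]; first by rewrite kE div0n !bin0.
  by move: lt_kd; rewrite kE mulSn ltnNge leq_addr.
rewrite (dvdn_subl le_dk (dvdnn d)); case: ifP => [/dvdnP[e kE]|_]; last by rewrite addr0.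
case: e kE => [|e] kE; first by move: le_dk; rewrite kE leqn0 gtn_eqF.
rewrite kE mulnK // mulSn addKn mulnK //.
by rewrite binS natrD.
Qed.
End RootOfUnity.

Section Recurrences.
Variables (K : fieldType).
Hypothesis K_char0 : forall n : nat, n.+1%:R != 0 :> K.

Let natr_inj : injective (fun i : nat => i%:R : K).
Proof.
have lt_neq i j : (i < j)%N -> i%:R != j%:R :> K.
  move=> lt_ij; rewrite -(subnKC lt_ij) addSnnS natrD -subr_eq0 opprD addNKr.
  by rewrite oppr_eq0 K_char0.
by move=> i j /eqP; case: (ltngtP i j) => // /lt_neq; [|rewrite eq_sym] => /negbTE ->.
Qed.

Let q_ i : K := i.+2%:R.

Let q_inj : injective q_. Proof. by move=> i j /natr_inj [->]. Qed.

Let q_neq0 i : q_ i != 0. Proof. exact: K_char0. Qed.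

Let q_pow i j : (0 < j)%N -> q_ i ^+ j != 1.
Proof.
move=> j_gt0; rewrite -natrX; apply/eqP => /(@natr_inj _ 1%N) /eqP.
by rewrite gtn_eqF // -{1}(exp1n j) ltn_exp2r.
Qed.

Lemma dexpoly_conv n (t r : K) :
  dexpoly n t r = \sum_(k < n.+1) r ^+ k *: (qbin K n k * dexpoly (n - k) t 0).
Proof.
apply: (poly_eq_infinite q_inj) => i; rewrite (dexpoly_conv_at (q_neq0 i)); last exact: q_pow.
rewrite horner_sum; apply: eq_bigr => k _; rewrite hornerZ hornerM -mulrA; congr (_ * (_ * _)).
have le_kn : (k <= n)%N by rewrite -ltnS.
have nz m : qpoch (q_ i) m != 0.
  by apply/prodf_neq0 => j _; rewrite subr_eq0 eq_sym q_pow.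
by rewrite -(qbin_qpoch (q_ i) le_kn) mulfK // mulf_neq0.
Qed.

Lemma dexpoly_t n (t : K) : (0 < n)%N -> dexpoly n t t = t *: dexpoly n t 1.
Proof.
move=> n_gt0; apply: (poly_eq_infinite q_inj) => i; rewrite hornerZ.
by apply: (dexpoly_t_at (q_neq0 i)) => // j; apply: q_pow.
Qed.

Lemma dexpoly_conv_prim d (w : K) k (t r : K) : d.-primitive_root w ->
  (dexpoly (d * k) t r).[w] =
  \sum_(e < k.+1) 'C(k, e)%:R * (r ^+ d) ^+ e * (dexpoly (d * (k - e)) t 0).[w].
Proof.
move=> w_prim; have d_gt0 := prim_order_gt0 w_prim.
rewrite dexpoly_conv horner_sum.
pose F j := 'C(k, j %/ d)%:R * r ^+ j * (dexpoly (d * k - j) t 0).[w].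
transitivity (\sum_(j < (d * k).+1 | (d %| j)%N) F j).
  rewrite [RHS]big_mkcond; apply: eq_bigr => j _; rewrite hornerZ hornerM qbin_prim_mull //.
  by case: ifP => _; rewrite ?mul0r ?mulr0 // /F mulrA [r ^+ j * _]mulrC.
have lt_de (e : 'I_k.+1) : (d * e < (d * k).+1)%N by rewrite ltnS leq_mul2l -ltnS ltn_ord orbT.
rewrite (reindex_onto (fun e : 'I_k.+1 => Ordinal (lt_de e)) (fun j => inord (j %/ d))) /=.
  apply: eq_big => [e|e _].
    by rewrite dvdn_mulr //= -val_eqE /= mulKn // inordK // eqxx.
  by rewrite /F mulKn // exprM mulnBr.
move=> j dvd_j; apply: val_inj => /=; rewrite inordK ?muln_divA // ?mulKn //.
by have := leq_div2r d (ltn_ord j : (j <= d * k)%N); rewrite mulKn.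
Qed.
End Recurrences.

Section Umbral.
Variable K : comNzRingType.
Implicit Types (x y : K) (a b : nat -> K).

Definition bshift x a (k : nat) : K := \sum_(e < k.+1) 'C(k, e)%:R * x ^+ e * a (k - e)%N.

Let umbra a (p : {poly K}) : K := \sum_(i < size p) p`_i * a i.

Let umbra_wide a n (p : {poly K}) : (size p <= n)%N -> umbra a p = \sum_(i < n) p`_i * a i.
Proof.
move=> le_n; rewrite /umbra (big_ord_widen n (fun i => p`_i * a i)) // big_mkcond /=.
by apply: eq_bigr => i _; case: ltnP => // le_i; rewrite nth_default ?mul0r.
Qed.

Let umbra_sum a n (F : 'I_n -> {poly K}) (c : 'I_n -> K) :
  umbra a (\sum_i c i *: F i) = \sum_i c i * umbra a (F i).
Proof.
pose m := \max_(i < n) size (F i).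
rewrite (umbra_wide _ (n := m)); last first.
  apply: (leq_trans (size_sum _ _ _)); apply/bigmax_leqP => i _.
  by apply: (leq_trans (size_scale_leq _ _)); apply: leq_bigmax.
under [RHS]eq_bigr => i _ do rewrite (umbra_wide _ (leq_bigmax (F := fun i => size (F i)) i)) mulr_sumr.
rewrite [RHS]exchange_big; apply: eq_bigr => j _ /=; rewrite coef_sum mulr_suml.
by apply: eq_bigr => i _; rewrite coefZ mulrA.
Qed.

Let bshiftE x a k : bshift x a k = umbra a (('X + x%:P) ^+ k).
Proof.
rewrite exprDn.
transitivity (umbra a (\sum_(e < k.+1) ('C(k, e)%:R * x ^+ e) *: 'X^(k - e))).
  rewrite umbra_sum; apply: eq_bigr => e _; congr (_ * _).
  rewrite (umbra_wide _ (n := (k - e).+1)) ?size_polyXn // big_ord_recr /=.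
  rewrite coefXn eqxx mul1r big1 ?add0r // => i _.
  by rewrite coefXn ltn_eqF ?mul0r // ltn_ord.
congr umbra; apply: eq_bigr => e _.
by rewrite -polyC_exp ['X^_ * _]mulrC mul_polyC scalerMnl mulr_natl.
Qed.

Lemma bshiftD x y a k : bshift x (bshift y a) k = bshift (x + y) a k.
Proof.
rewrite [RHS]bshiftE polyCD addrA -[_ + _ + y%:P]addrAC exprDn {1}/bshift.
under eq_bigr do rewrite bshiftE.
rewrite -umbra_sum; congr umbra; apply: eq_bigr => e _.
by rewrite -polyC_exp [('X + _) ^+ _ * _]mulrC mul_polyC scalerMnl mulr_natl.
Qed.
End Umbral.

Section QInt.
Variable K : comNzRingType.
Implicit Type t : K.

Lemma qintSl d t : qint d.+1 t = 1 + t * qint d t.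
Proof.
rewrite /qint big_ord_recl expr0 mulr_sumr; congr (_ + _).
by apply: eq_bigr => i _; rewrite -exprS.
Qed.

Lemma qintSr d t : qint d.+1 t = qint d t + t ^+ d.
Proof. by rewrite /qint big_ord_recr. Qed.

Lemma sum_rev_exp d t : \sum_(i < d) t ^+ (d - i) = t * qint d t.
Proof.
rewrite /qint mulr_sumr (reindex_inj rev_ord_inj); apply: eq_bigr => i _.
by rewrite /= -exprS; congr (_ ^+ _); have := ltn_ord i; lia.
Qed.
End QInt.

Lemma dexpoly1 (K : comNzRingType) (n : nat) (t s : K) :
  (dexpoly n t s).[1] = A_exc_fix n t s.
Proof.
by rewrite horner_sum; apply: eq_bigr => sigma _; rewrite hornerZ hornerXn expr1n mulr1.
Qed.

Lemma A_maj_exc_fix_dexpoly (K : fieldType) (n : nat) (w t s : K) : w != 0 ->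
  A_maj_exc_fix n w (t * w^-1) s = (dexpoly n t s).[w].
Proof.
move=> w_neq0; rewrite horner_sum; apply: eq_bigr => sigma _.
rewrite hornerZ hornerXn maj_dexsum exprD exprMn exprVn.
have : w ^+ exc sigma != 0 by rewrite expf_neq0.
by move: (w ^+ exc sigma) => x x_neq0; field.
Qed.

Lemma eq_bshift (K : comNzRingType) (x : K) (a b : nat -> K) k :
  a =1 b -> bshift x a k = bshift x b k.
Proof. by move=> ab; apply: eq_bigr => e _; rewrite ab. Qed.

Lemma bshift_scale (K : comNzRingType) (u x : K) (a : nat -> K) k :
  bshift (u * x) (fun k => u ^+ k * a k) k = u ^+ k * bshift x a k.
Proof.
rewrite /bshift mulr_sumr; apply: eq_bigr => e _.
have le_ek : (e <= k)%N by rewrite -ltnS.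
have -> : u ^+ k = u ^+ e * u ^+ (k - e) by rewrite -exprD subnKC.
by rewrite exprMn; ring.
Qed.

Lemma bshift_unique (K : idomainType) (t x y : K) (a b : nat -> K) : t != 1 ->
  a 0%N = b 0%N ->
  (forall k, (0 < k)%N -> bshift x a k = t * bshift y a k) ->
  (forall k, (0 < k)%N -> bshift x b k = t * bshift y b k) -> a =1 b.
Proof.
move=> t_neq1 ab0 Ha Hb k; elim/ltn_ind: k => -[//|k] IH.
have split_a (z : K) (c : nat -> K) : bshift z c k.+1 =
    c k.+1 + \sum_(e < k.+1) 'C(k.+1, e.+1)%:R * z ^+ e.+1 * c (k - e)%N.
  by rewrite /bshift big_ord_recl bin0 expr0 !mul1r subn0.
have eq_tail z : \sum_(e < k.+1) 'C(k.+1, e.+1)%:R * z ^+ e.+1 * a (k - e)%N =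
    \sum_(e < k.+1) 'C(k.+1, e.+1)%:R * z ^+ e.+1 * b (k - e)%N.
  by apply: eq_bigr => e _; rewrite IH // ltnS leq_subr.
have := Ha k.+1 isT; have := Hb k.+1 isT; rewrite !split_a !eq_tail.
set S1 := \sum_(e < k.+1) _; set S2 := \sum_(e < k.+1) _ => Eb Ea.
have nz : 1 - t != 0 by rewrite subr_eq0 eq_sym.
apply: (mulfI nz).
have -> : (1 - t) * a k.+1 = a k.+1 + S1 - t * (a k.+1 + S2) - S1 + t * S2 by ring.
have -> : (1 - t) * b k.+1 = b k.+1 + S1 - t * (b k.+1 + S2) - S1 + t * S2 by ring.
by rewrite Ea Eb !subrr.
Qed.

Lemma dexpoly_prim_A_exc_fix (K : fieldType) (d k : nat) (w t s : K) :
  (forall n : nat, n.+1%:R != 0 :> K) -> d.-primitive_root w -> t != 1 -> qint d t != 0 ->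
  (dexpoly (d * k) t s).[w] =
  A_exc_fix k t ((s ^+ d + t * qint d.-1 t) / qint d t) * qint d t ^+ k.
Proof.
move=> K_char0 w_prim t_neq1 u_neq0; have d_gt0 := prim_order_gt0 w_prim.
set u := qint d t in u_neq0 *; set c := t * qint d.-1 t.
have one_prim : 1.-primitive_root (1 : K).
  by apply/andP; split=> //; apply/forallP => i; rewrite ord1 unity_rootE expr1n !eqxx.
pose a j := (dexpoly (d * j) t 0).[w]; pose b j := A_exc_fix j t (0 : K).
pose b' j := u ^+ j * b j; pose a' := bshift c b'.
have aE r j : bshift (r ^+ d) a j = (dexpoly (d * j) t r).[w].
  by rewrite (dexpoly_conv_prim K_char0).
have bE r j : bshift r b j = A_exc_fix j t r.
  rewrite -dexpoly1 -[j in RHS]mul1n (dexpoly_conv_prim K_char0 _ _ _ one_prim).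
  by apply: eq_bigr => e _; rewrite mul1n dexpoly1 expr1.
have cS : (t ^+ d + c = u * t) /\ (1 + c = u * 1).
  rewrite /u /c; case: (d) d_gt0 => // d' _ /=; split; last by rewrite qintSl mulr1.
  by rewrite qintSr exprS; ring.
have b_rec j : (0 < j)%N -> bshift t b j = t * bshift 1 b j.
  by move=> j_gt0; rewrite !bE -!dexpoly1 dexpoly_t // hornerZ.
have aa' : a =1 a'.
  apply: (@bshift_unique _ t (t ^+ d) 1 a a' t_neq1).
  - by rewrite /a' /bshift big_ord1 /b' !mul1r /b -dexpoly1 /a muln0 /dexpoly !horner_sum;
      apply: eq_bigr => sigma _; rewrite /dexsum big_pred0 ?hornerZ ?hornerXn // => -[].
  - move=> j j_gt0; rewrite aE -[X in bshift X _ _](expr1n K d) aE.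
    by rewrite dexpoly_t ?muln_gt0 ?d_gt0 // hornerZ.
  move=> j j_gt0; rewrite !bshiftD cS.1 cS.2 !bshift_scale b_rec //; ring.
rewrite -aE (eq_bshift _ _ aa') bshiftD -[X in bshift X _ _](mulfVK u_neq0) mulrC.
by rewrite -bE -[in RHS]mulrC -bshift_scale mulrC.
Qed.

Section Wreath.
Variables (d' k' : nat).
Local Notation d := d'.+1.
Local Notation k := k'.+1.
Local Notation n := (d * k)%N.
Implicit Types (a : 'I_k) (b : 'I_d) (j : 'I_n) (sigma : 'S_n).

Fact cell_subproof a b : (b * k + a < n)%N.
Proof. by have := ltn_ord a; have := ltn_ord b; nia. Qed.

Definition cell a b : 'I_n := Ordinal (cell_subproof a b).

Fact blk_subproof j : (j %/ k < d)%N.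
Proof. by rewrite ltn_divLR. Qed.

Definition res j : 'I_k := Ordinal (ltn_pmod j (ltn0Sn k')).
Definition blk j : 'I_d := Ordinal (blk_subproof j).

Lemma res_cell a b : res (cell a b) = a.
Proof. by apply: val_inj; rewrite /= modnMDl modn_small. Qed.

Lemma blk_cell a b : blk (cell a b) = b.
Proof. by apply: val_inj; rewrite /= divnMDl // divn_small // addn0. Qed.

Lemma cellK j : cell (res j) (blk j) = j.
Proof. by apply: val_inj; rewrite /= -divn_eq. Qed.

Lemma cell_inj a b a2 b2 : cell a b = cell a2 b2 -> a = a2 /\ b = b2.
Proof.
move=> eq_cell; split.
  by rewrite -(res_cell a b) eq_cell res_cell.
by rewrite -(blk_cell a b) eq_cell blk_cell.
Qed.

Lemma big_cell (R : Type) (idx : R) (op : Monoid.com_law idx) (F : 'I_n -> R) :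
  \big[op/idx]_j F j = \big[op/idx]_a \big[op/idx]_b F (cell a b).
Proof.
rewrite pair_big /= (reindex (fun p : 'I_k * 'I_d => cell p.1 p.2)) //=.
apply: onW_bij; exists (fun j => (res j, blk j)) => [[a b]|j] /=.
  by rewrite res_cell blk_cell.
by rewrite cellK.
Qed.

Definition wreath_fun (p : 'S_k * {ffun 'I_k -> 'I_d}) j : 'I_n :=
  cell (p.1 (res j)) (blk j + p.2 (res j)).

Lemma wreath_fun_inj p : injective (wreath_fun p).
Proof.
move=> i j /cell_inj[/perm_inj eq_res]; rewrite eq_res => /addIr eq_blk.
by rewrite -(cellK i) -(cellK j) eq_res eq_blk.
Qed.

Definition wreath p : 'S_n := perm (@wreath_fun_inj p).

Lemma wreathE p a b : wreath p (cell a b) = cell (p.1 a) (b + p.2 a).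
Proof. by rewrite permE /wreath_fun res_cell blk_cell. Qed.

Lemma wreath_inj : injective wreath.
Proof.
move=> [pi f] [pi2 f2] eq_w.
have eq_a a : pi a = pi2 a /\ f a = f2 a.
  have := congr1 (fun s : 'S_n => s (cell a 0)) eq_w.
  by rewrite /= !wreathE !add0r => /cell_inj.
congr pair; first by apply/permP => a; have [] := eq_a a.
by apply/ffunP => a; have [] := eq_a a.
Qed.

Lemma gammaX i j : ((gamma n ^+ i)%g j = (j + i) %% n :> nat)%N.
Proof.
elim: i => [|i IH]; first by rewrite expg0 perm1 addn0 modn_small.
by rewrite expgSr permM permE /= IH -addn1 modnDml addn1 addnS.
Qed.

Lemma gamma_cell a b : (gamma n ^+ k)%g (cell a b) = cell a (b + inZp 1).
Proof.
apply: ord_inj; rewrite gammaX /= modnDmr addnAC -{2}[k]mul1n -mulnDl.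
have lt_a := ltn_ord a; have := ltn_ord b; rewrite ltnS leq_eqVlt => /orP[/eqP eq_b|lt_b].
  rewrite eq_b addn1 modnn mul0n modnDl modn_small //.
  by rewrite (leq_trans lt_a) // leq_pmull.
rewrite [((b + 1) %% _)%N]modn_small ?addn1 // modn_small //.
by nia.
Qed.

Lemma wreath_cent p : wreath p \in 'C[(gamma n ^+ k)%g]%g.
Proof.
apply/cent1P; apply/permP => j; rewrite !permM -(cellK j).
by rewrite wreathE !gamma_cell wreathE addrAC.
Qed.

Lemma cent_wreath sigma : sigma \in 'C[(gamma n ^+ k)%g]%g -> exists p, sigma = wreath p.
Proof.
move=> /cent1P comm.
have step a b : sigma (cell a (b + inZp 1)) =
    cell (res (sigma (cell a b))) (blk (sigma (cell a b)) + inZp 1).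
  by rewrite -!gamma_cell cellK -!permM comm.
pose g a := res (sigma (cell a 0)); pose f a := blk (sigma (cell a 0)).
have sigmaE a b : sigma (cell a b) = cell (g a) (b + f a).
  rewrite -(valZpK b); elim: (val b) => [|m IH].
    have -> : inZp 0 = 0 :> 'I_d by apply: val_inj; rewrite /= mod0n.
    by rewrite add0r cellK.
  have -> : inZp m.+1 = inZp m + inZp 1 :> 'I_d.
    by apply: val_inj; rewrite /= modnDm addn1.
  by rewrite step IH res_cell blk_cell addrAC.
have g_inj : injective g.
  move=> a a2 eq_g; have : sigma (cell a (f a2)) = sigma (cell a2 (f a)).
    by rewrite !sigmaE eq_g addrC.
  by move/perm_inj/cell_inj => [].
exists (perm g_inj, [ffun a => f a]); apply/permP => j; rewrite -(cellK j).
by rewrite wreathE sigmaE permE ffunE.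
Qed.

Lemma sum_cent (R : nmodType) (F : 'S_n -> R) :
  \sum_(sigma in 'C[(gamma n ^+ k)%g]%g) F sigma = \sum_p F (wreath p).
Proof.
transitivity (\sum_(sigma in wreath @: setT) F sigma); last first.
  by rewrite big_imset => [|p r _ _ /wreath_inj //]; apply: eq_bigl => p; rewrite inE.
apply: eq_bigl => sigma; apply/idP/imsetP => [/cent_wreath[p ->]|[p _ ->]]; first by exists p.
exact: wreath_cent.
Qed.

Section Weight.
Variables (K : comNzRingType) (t s : K).

Let entry (i j : 'I_n) : K := if j == i then s else if (i < j)%N then t else 1.

Let prod_carry (f : 'I_d) : \prod_(b < d) (if (b + f < d)%N then t else 1) = t ^+ (d - f).
Proof.
rewrite -big_mkcond prodr_const; congr (_ ^+ _).
rewrite -[RHS]subn0 -(@card_ord_itv d 0) ?leq_subr //; apply: eq_card => b.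
by rewrite !inE unfold_in /=; have := ltn_ord f; lia.
Qed.

Lemma sum_cell_weight a a2 :
  \sum_(f : 'I_d) \prod_b entry (cell a b) (cell a2 (b + f)) =
  if a2 == a then s ^+ d + t * qint d' t
  else if (a < a2)%N then t * qint d t else qint d t.
Proof.
have cell_lt b b2 : (cell a b < cell a2 b2)%N = (b < b2)%N || (b == b2) && (a < a2)%N.
  by rewrite lex_ltn.
have cell_eq b b2 : (cell a2 b2 == cell a b) = (a2 == a) && (b2 == b).
  by apply/eqP/andP => [/cell_inj[-> ->]|[/eqP-> /eqP->]].
rewrite big_ord_recl.
have -> : \prod_b entry (cell a b) (cell a2 (b + ord0)) =
    (if a2 == a then s else if (a < a2)%N then t else 1) ^+ d.
  rewrite -[X in _ = _ ^+ X](card_ord d) -prodr_const; apply: eq_bigr => b _.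
  have -> : b + ord0 = b by exact: addr0.
  by rewrite /entry cell_eq cell_lt eqxx ltnn andbT.
have -> : \sum_(i < d') \prod_b entry (cell a b) (cell a2 (b + lift ord0 i)) = t * qint d' t.
  rewrite -sum_rev_exp; apply: eq_bigr => i _; rewrite -subSS -(lift0 i) -prod_carry.
  apply: eq_bigr => b _; rewrite /entry cell_eq cell_lt.
  have carry_neq : (b + lift ord0 i == b) = false.
    by rewrite -{2}[b]addr0 (inj_eq (addrI b)).
  rewrite [b == _]eq_sym carry_neq andbF orbF; congr (if _ then _ else _).
  rewrite /= /bump /= add1n; have lt_b := ltn_ord b; have lt_i := ltn_ord i.
  case: (ltnP (b + i.+1) d) => [lt_d|le_d]; first by rewrite modn_small //; lia.
  have -> : (b + i.+1 = (b + i.+1 - d) + d)%N by rewrite subnK.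
  by rewrite modnDr modn_small; lia.
case: ifP => _ //; case: ifP => _; last by rewrite expr1n qintSl.
by rewrite qintSr exprS; ring.
Qed.

Lemma sum_wreath_weight :
  \sum_(sigma in 'C[(gamma n ^+ k)%g]%g) t ^+ exc sigma * s ^+ fix_ sigma =
  \sum_(pi : 'S_k) \prod_a
    (if pi a == a then s ^+ d + t * qint d' t
     else if (a < pi a)%N then t * qint d t else qint d t).
Proof.
transitivity (\sum_(pi : 'S_k) \sum_(f : {ffun 'I_k -> 'I_d})
    t ^+ exc (wreath (pi, f)) * s ^+ fix_ (wreath (pi, f))).
  by rewrite sum_cent pair_big; apply: eq_bigr => -[pi f].
apply: eq_bigr => pi _.
under [RHS]eq_bigr do rewrite -sum_cell_weight.
rewrite bigA_distr_bigA; apply: eq_bigr => f _; rewrite exc_fix_prod big_cell.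
by apply: eq_bigr => a _; apply: eq_bigr => b _; rewrite wreathE.
Qed.
End Weight.
End Wreath.

Lemma sum_cent_A_exc_fix (K : fieldType) (d k : nat) (t s : K) :
  (0 < d)%N -> (0 < k)%N -> qint d t != 0 ->
  \sum_(sigma in 'C[(gamma (d * k) ^+ k)%g]%g) t ^+ exc sigma * s ^+ fix_ sigma =
  A_exc_fix k t ((s ^+ d + t * qint d.-1 t) / qint d t) * qint d t ^+ k.
Proof.
case: d k => [|d] [|k] // _ _ u_neq0; rewrite sum_wreath_weight /A_exc_fix mulr_suml.
apply: eq_bigr => pi _; rewrite exc_fix_prod -[X in _ * _ ^+ X]card_ord -prodr_const.
rewrite -big_split /=; apply: eq_bigr => a _.
by case: ifP => _; [rewrite divfK | case: ifP => _; rewrite ?mul1r].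
Qed.

Section RationalFunctions.
Variable C : fieldType.

Lemma tofrac_meval_neq0 (p : {mpoly C[2]}) (v : 'I_2 -> C) :
  p.@[v] != 0 -> (tofrac p : ratfun C) != 0.
Proof. by rewrite tofrac_eq0; apply: contraNN => /eqP ->; rewrite meval0. Qed.

Lemma ratfun_char0 : (forall n : nat, n.+1%:R != 0 :> C) ->
  forall n : nat, n.+1%:R != 0 :> ratfun C.
Proof.
move=> C_char0 n; rewrite -(rmorph_nat (@tofrac _)).
by apply: (tofrac_meval_neq0 (v := fun=> 0)); rewrite rmorph_nat.
Qed.

Lemma tvar_neq1 : tvar C != 1.
Proof.
rewrite -subr_eq0 -(rmorph1 (@tofrac _)) -rmorphB.
apply: (tofrac_meval_neq0 (v := fun=> 0)).
by rewrite mevalB mevalXU meval1 sub0r oppr_eq0 oner_eq0.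
Qed.

Lemma qint_tvar_neq0 d : (0 < d)%N -> qint d (tvar C) != 0.
Proof.
case: d => // d _.
have -> : qint d.+1 (tvar C) = tofrac (qint d.+1 ('X_ord0 : {mpoly C[2]})).
  by rewrite rmorph_sum; apply: eq_bigr => i _; rewrite rmorphXn.
apply: (tofrac_meval_neq0 (v := fun=> 0)).
by rewrite qintSl mevalD mevalM meval1 mevalXU mul0r addr0 oner_eq0.
Qed.

Lemma ratC_prim d (w : C) : d.-primitive_root w -> d.-primitive_root (ratC w).
Proof.
move=> w_prim.
pose f : {rmorphism C -> ratfun C} := (@tofrac _) \o (@mpolyC 2 C).
by rewrite -[ratC w]/(f w) fmorph_primitive_root.
Qed.
End RationalFunctions.

Lemma A_maj_exc_fix_prim (K : fieldType) (d k : nat) (w t s : K) :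
  (forall n : nat, n.+1%:R != 0 :> K) -> d.-primitive_root w -> t != 1 -> qint d t != 0 ->
  A_maj_exc_fix (d * k) w (t * w^-1) s =
  A_exc_fix k t ((s ^+ d + t * qint d.-1 t) / qint d t) * qint d t ^+ k.
Proof.
move=> K_char0 w_prim t_neq1 u_neq0; have d_gt0 := prim_order_gt0 w_prim.
rewrite A_maj_exc_fix_dexpoly ?dexpoly_prim_A_exc_fix //.
apply/eqP => w0; have /eqP := prim_expr_order w_prim.
by rewrite w0 expr0n gtn_eqF // eq_sym oner_eq0.
Qed.

Theorem theorem6p1 (R : realType) (n d k : nat) (d_gt0 : (0 < d)%N)
    (k_gt0 : (0 < k)%N) (n_dk : n = (d * k)%N)
    (w : complex R) (w_prim : d.-primitive_root w) :
  let t := tvar (complex R) in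
  let s := svar (complex R) in
  let omega := ratC w in
  let E1 := A_maj_exc_fix n omega (t * omega^-1) s in
  let E2 := \sum_(sigma in 'C[(gamma n ^+ k)%g]%g)
              t ^+ exc sigma * s ^+ fix_ sigma in
  let E3 := A_exc_fix k t ((s ^+ d + t * qint d.-1 t) / qint d t)
              * qint d t ^+ k in
  E1 = E2 /\ E2 = E3.
Proof.
move=> t s omega E1 E2 E3; subst n.
have omega_prim : d.-primitive_root omega by exact: ratC_prim.
have u_neq0 : qint d t != 0 by exact: qint_tvar_neq0.
have E23 : E2 = E3 by exact: sum_cent_A_exc_fix.
have char0 := ratfun_char0 (fun m => negbT (Num.Theory.pnatr_eq0 (complex R) m.+1)).
split; last exact: E23; rewrite E23.
exact: (A_maj_exc_fix_prim k s char0 omega_prim (tvar_neq1 _) u_neq0).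
Qed.
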